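(* Let $\mathcal{G}=(\mathcal{V},\mathcal{E})$ be a generically $d$-rigid graph on $n$ vertices and let the target configuration $p^*$ be generic, with $m^*=F(p^* )$. If a controller $$\dot p=\nu_{(p,m)}(m^*-m),\qquad \dot m=\eta_{(p,m)}(m^*-m)$$ in the edge-driven family, defined by rational functions, is locally exponentially stable for some such target formation $(p^*,m^* )\in\mathcal{S}$, then it is dynamically admissible.
   Context: Setting. $\mathcal{G}=(\mathcal{V},\mathcal{E})$ is a finite simple undirected graph with $\mathcal{V}=\{1,\dots,n\}$, and $d\ge1$. A configuration is $p=(p_1,\dots,p_n)\in(\mathbb{R}^d)^n=\mathbb{R}^{dn}$. Two configurations are congruent if they differ by an isometry of $\mathbb{R}^d$ applied to all points. Norms are Euclidean. Distance map: $F:\mathbb{R}^{dn}\to\mathbb{R}^{|\mathcal{E}|}$, $F(p)=(\|p_j-p_i\|^2)_{ij\in\mathcal{E}}$. Rigidity matrix: $R(p)\in\mathbb{R}^{|\mathcal{E}|\times dn}$; the row of the edge $ij$ has $(p_i-p_j)^\top$ in the block of columns of vertex $i$, $(p_j-p_i)^\top$ in the block of vertex $j$, and zeros elsewhere. Thus $R(p)p=F(p)$ and $\mathrm{d}F_p=2R(p)$. Regular values and points: let $r=\max_p\mathrm{rk}\,R(p)$. $\mathcal{Q}$ is the set of regular values of $F$: the points $m\in\mathrm{Im}\,F$ near which $\mathrm{Im}\,F$ is an embedded smooth submanifold of $\mathbb{R}^{|\mathcal{E}|}$ of dimension $r$ and such that $\mathrm{rk}\,R(p)=r$ for every $p\in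 F^{-1}(m)$. $\mathcal{C}:=F^{-1}(\mathcal{Q})$ is the set of regular points of $F$. For $m=F(p)\in\mathcal{Q}$, $T_m\mathcal{Q}=\mathrm{Im}\,R(p)$. Rigidity: $(\mathcal{G},p)$ is locally rigid if there is a neighborhood of $p$ in which every $q$ with $F(q)=F(p)$ is congruent to $p$. $\mathcal{G}$ is $d$-rigid (also called generically $d$-rigid) if $(\mathcal{G},p)$ is locally rigid for every configuration $p$ such that $F(p)$ is a smooth point of the image of $F$; in particular, $(\mathcal{G},p)$ is then locally rigid for every regular $p$. Genericity: a statement holds for generic $p$ if it holds for all $p$ in the open, dense complement of an unspecified exceptional set that is defined by polynomials with rational coefficients. Every generic configuration is regular. A target $(p^*,m^* )$ is generic if $p^*$ is generic and $m^*=F(p^* )$. State space: $\mathcal{S}=\{(p,m)\in\mathcal{C}\times\mathcal{Q}:F(p)=m\}$, with $T_{(p,m)}\mathcal{S}=\{(\dot p,\dot m):\dot m=2R(p)\dot p\}$. Edge-driven controller family: a controller is given by linear maps $\nu_{(p,m)}:\mathbb{R}^{|\mathcal{E}|}\to\mathbb{R}^{dn}$ and $\eta_{(p,m)}:\mathbb{R}^{|\mathcal{E}|}\to\mathbb{R}^{|\mathcal{E}|}$, depending on the state $(p,m)\in\mathcal{S}$ (controllers defined only on an open neighborhood in $\mathcal{S}$ of the target $(p^*,m^* )$ are also allowed), such that $(\nu_{(p,m)}x,\eta_{(p,m)}x)\in T_{(p,m)}\mathcal{S}$ for all states and all $x\in\mathbb{R}^{|\mathcal{E}|}$, i.e. $\eta_{(p,m)}=2R(p)\nu_{(p,m)}$.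 It is defined by rational functions if $\nu_{(p,m)}$ and $\eta_{(p,m)}$ are rational functions of $(p,m)$. Given a target $(p^*,m^* )$ and a starting configuration $p^0$, one solves the displayed system with $p(0)=p^0$, $m(0)=F(p^0)$; the solution $(p(t),m(t))$ lies in $\mathcal{S}$. Locally exponentially stable for the target $(p^*,m^* )$: there is a neighborhood $U\subseteq\mathcal{S}$ of $(p^*,m^* )$ and constants $C,c,K,k>0$ such that for every initial condition in $U$ one has, for all $t\ge0$, $\|m^*-m(t)\|\le Ce^{-ct}$, and there is a configuration $q$ congruent to $p^*$ with $\|q-p(t)\|\le Ke^{-kt}$ for all $t\ge0$. Dynamically admissible: for every generic target $(p^*,m^* )\in\mathcal{S}$ (in the domain of definition of the controller), with $\eta^*:=\eta_{(p^*,m^* )}$, the restriction $\eta^*|_{T_{m^*}\mathcal{Q}}:T_{m^*}\mathcal{Q}\to T_{m^*}\mathcal{Q}$ is hyperbolic, i.e. all its (complex) eigenvalues have non-zero real part.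
   Formalization: For a controller whose rational functions have coefficients in a field K, the generic targets in ''dynamically admissible'' avoid a set defined over K (over the rationals when K is the rationals); with real coefficients and a rational exceptional set the claim fails, e.g. one edge, d=1, η=p_1−π. *)

(* Defs.v *)
From HB Require Import structures.
From mathcomp Require Import all_boot all_order all_algebra.
From mathcomp Require Import complex.
From mathcomp Require mpoly.
From mathcomp Require Import all_classical all_reals all_analysis.

Set Implicit Arguments.
Unset Strict Implicit.
Unset Printing Implicit Defensive.

Import Order.TTheory GRing.Theory Num.Theory.
Import numFieldNormedType.Exports.

Local Open Scope classical_set_scope.
Local Open Scope ring_scope.

(* The library norm on matrices is the sup norm; it induces the same topology
   as the Euclidean one below. *)
Definition enorm (R : realType) (a b : nat) (A : 'M[R]_(a, b)) : R :=
  Num.sqrt (\sum_i \sum_j A i j ^+ 2).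

(* [C^k] on [U]: for open [U], existence and continuity of all iterated
   directional derivatives up to order [k]. *)
Fixpoint class_C (R : realType) (V W : normedModType R) (k : nat)
    (U : set V) (f : V -> W) : Prop :=
  (forall x, U x -> {for x, continuous f}) /\
  (if k is k'.+1 then
     forall v : V, (forall x, U x -> derivable f x v) /\
                   class_C k' U (fun x => 'D_v f x)
   else True).

Definition smooth_on (R : realType) (V W : normedModType R)
    (U : set V) (f : V -> W) : Prop := forall k, class_C k U f.

(* Existence of a slice chart: a diffeomorphism [phi : U -> V] with inverse
   [psi], [U] an open neighborhood of [m], which maps [U `&` M] onto
   [V `&` (R^r x 0)]. *)
Definition embedded_submanifold_near (R : realType) (N r : nat)
    (M : set 'cV[R]_N) (m : 'cV[R]_N) : Prop :=
  exists (U V : set 'cV[R]_N) (phi psi : 'cV[R]_N -> 'cV[R]_N),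
    [/\ open U /\ open V,
        U m,
        smooth_on U phi /\ smooth_on V psi,
        (forall x, U x -> V (phi x) /\ psi (phi x) = x) /\
        (forall y, V y -> U (psi y) /\ phi (psi y) = y) &
        forall x, U x ->
          (M x <-> forall i : 'I_N, (r <= i)%N -> phi x i 0 = 0)].

(* A configuration is a matrix [p : 'M[R]_(n, d)] whose [i]-th row is the
   position of vertex [i]; [mxvec] identifies it with a vector of [R^(n*d)]. *)

Definition congruent (R : realType) (n d : nat) (p q : 'M[R]_(n, d)) : Prop :=
  exists2 g : 'rV[R]_d -> 'rV[R]_d,
    (forall x y, enorm (g x - g y) = enorm (x - y)) &
    (forall i, row i q = g (row i p)).

(* Each edge of the simple graph is listed once, as [(i, j)] with [i < j]. *)
Definition edges (n : nat) (G : rel 'I_n) : {set 'I_n * 'I_n} :=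
  [set ij : 'I_n * 'I_n | (ij.1 < ij.2)%N && G ij.1 ij.2].

Definition distance_map (R : realType) (n d : nat) (G : rel 'I_n)
    (p : 'M[R]_(n, d)) : 'cV[R]_#|edges G| :=
  \col_k (let: (i, j) := enum_val k in enorm (row j p - row i p) ^+ 2).

Definition rigidity_mx (R : realType) (n d : nat) (G : rel 'I_n)
    (p : 'M[R]_(n, d)) : 'M[R]_(#|edges G|, n * d) :=
  \matrix_(k < #|edges G|)
    (let: (i, j) := enum_val k in
     mxvec (\matrix_(v < n)
       (if v == i then row i p - row j p
        else if v == j then row j p - row i p
        else 0))).

Definition max_rank (R : realType) (n d : nat) (G : rel 'I_n) : nat :=
  (\max_(k < #|edges G|.+1 |
     `[< exists p : 'M[R]_(n, d), \rank (rigidity_mx G p) = k >]) k)%N.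

Definition smooth_value (R : realType) (n d : nat) (G : rel 'I_n)
    (m : 'cV[R]_#|edges G|) : Prop :=
  range (@distance_map R n d G) m /\
  embedded_submanifold_near (max_rank R d G) (range (@distance_map R n d G)) m.

Definition regular_value (R : realType) (n d : nat) (G : rel 'I_n)
    (m : 'cV[R]_#|edges G|) : Prop :=
  smooth_value d m /\
  forall p : 'M[R]_(n, d), distance_map G p = m ->
    \rank (rigidity_mx G p) = max_rank R d G.

Definition regular_point (R : realType) (n d : nat) (G : rel 'I_n)
    (p : 'M[R]_(n, d)) : Prop := regular_value d (distance_map G p).

Definition locally_rigid (R : realType) (n d : nat) (G : rel 'I_n)
    (p : 'M[R]_(n, d)) : Prop :=
  \forall q \near p, distance_map G q = distance_map G p -> congruent p q.

Definition d_rigid (R : realType) (n d : nat) (G : rel 'I_n) : Prop :=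
  forall p : 'M[R]_(n, d),
    smooth_value d (distance_map G p) -> locally_rigid G p.

(* [iota : K -> R] embeds the field of coefficients; [iota = ratr], with
   [K = rat], is the case of polynomials with rational coefficients. *)
Definition peval (R : realType) (K : fieldType) (iota : {rmorphism K -> R})
    (N : nat) (f : mpoly.mpoly N K) (x : 'rV[R]_N) : R :=
  mpoly.mmap iota (fun k => x 0 k) f.

Definition zero_locus (R : realType) (K : fieldType)
    (iota : {rmorphism K -> R}) (n d : nat)
    (fs : seq (mpoly.mpoly (n * d) K)) : set 'M[R]_(n, d) :=
  [set p | all (fun f => peval iota f (mxvec p) == 0) fs].

Definition generically (R : realType) (K : fieldType)
    (iota : {rmorphism K -> R}) (n d : nat)
    (P : 'M[R]_(n, d) -> Prop) : Prop :=
  exists fs : seq (mpoly.mpoly (n * d) K),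
    [/\ open (~` zero_locus iota fs),
        dense (~` zero_locus iota fs) &
        forall p, ~ zero_locus iota fs p -> P p].

Notation state R n d G := ('M[R]_(n, d) * 'cV[R]_#|edges G|)%type.

Definition state_space (R : realType) (n d : nat) (G : rel 'I_n) :
    set (state R n d G) :=
  [set s | [/\ regular_point G s.1, regular_value d s.2 &
               distance_map G s.1 = s.2]].

(* A controller on the relatively open subset [D] of the state space; the
   values of [nu] and [eta] outside [D] are irrelevant. *)
Definition edge_driven (R : realType) (n d : nat) (G : rel 'I_n)
    (D : set (state R n d G))
    (nu : state R n d G -> 'M[R]_(n * d, #|edges G|))
    (eta : state R n d G -> 'M[R]_#|edges G|) : Prop :=
  (exists2 O, open O & D = @state_space R n d G `&` O) /\
  (forall s, D s -> eta s = 2 *: (rigidity_mx G s.1 *m nu s)).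

Definition rational_on (R : realType) (K : fieldType)
    (iota : {rmorphism K -> R}) (n d N : nat)
    (D : set ('M[R]_(n, d) * 'cV[R]_N))
    (a b : nat) (A : 'M[R]_(n, d) * 'cV[R]_N -> 'M[R]_(a, b)) : Prop :=
  forall i j, exists num den : mpoly.mpoly (n * d + N) K,
    forall s, D s ->
      let x := row_mx (mxvec s.1) s.2^T in
      peval iota den x != 0 /\
      A s i j = peval iota num x / peval iota den x.

(* On [0, +oo[ the differential equation is imposed for [t > 0]; continuity
   at [0] then gives it there for the right derivative. *)
Definition is_solution (R : realType) (n d : nat) (G : rel 'I_n)
    (D : set (state R n d G))
    (nu : state R n d G -> 'M[R]_(n * d, #|edges G|))
    (eta : state R n d G -> 'M[R]_#|edges G|)
    (mstar : 'cV[R]_#|edges G|)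
    (p : R -> 'M[R]_(n, d)) (m : R -> 'cV[R]_#|edges G|) : Prop :=
  [/\ forall t : R, 0 <= t -> D (p t, m t),
      {within `[0, +oo[, continuous p} /\ {within `[0, +oo[, continuous m} &
      forall t : R, 0 < t ->
        is_derive t 1 p (vec_mx (nu (p t, m t) *m (mstar - m t))^T) /\
        is_derive t 1 m (eta (p t, m t) *m (mstar - m t))].

Definition locally_exp_stable (R : realType) (n d : nat) (G : rel 'I_n)
    (D : set (state R n d G))
    (nu : state R n d G -> 'M[R]_(n * d, #|edges G|))
    (eta : state R n d G -> 'M[R]_#|edges G|)
    (pstar : 'M[R]_(n, d)) : Prop :=
  let mstar := distance_map G pstar in
  exists (U : set (state R n d G)) (C c K k : R),
    [/\ U `<=` @state_space R n d G,
        within (@state_space R n d G) (nbhs (pstar, mstar)) U,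
        [/\ 0 < C, 0 < c, 0 < K & 0 < k] &
        forall s, U s ->
          exists (p : R -> 'M[R]_(n, d)) (m : R -> 'cV[R]_#|edges G|),
            [/\ is_solution D nu eta mstar p m,
                p 0 = s.1 /\ m 0 = s.2,
                forall t : R, 0 <= t -> enorm (mstar - m t) <= C * expR (- c * t) &
                exists2 q, congruent pstar q &
                  forall t : R, 0 <= t -> enorm (q - p t) <= K * expR (- k * t)]].

(* The operator [x |-> A *m x] acts on row vectors as [A^T], and the column
   space of [B] is the row space of [B^T]; [restrictmx] is then the matrix of
   the restricted operator in a basis of that space. *)
Definition hyperbolic_on (R : realType) (a b : nat)
    (B : 'M[R]_(a, b)) (A : 'M[R]_a) : Prop :=
  forall lambda : R[i],
    eigenvalue (map_mx (real_complex R) (restrictmx B^T A^T)) lambda ->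
    complex.Re lambda != 0.

(* The tangent space of the manifold of regular values at
   [distance_map G p] is the column space of [rigidity_mx G p].
   The exceptional set is defined over the field [K] of coefficients of the
   controller: for [K = rat] this is genericity in the usual sense, and a
   controller with a coefficient such as [pi] can fail to be hyperbolic on a
   hypersurface that no rational polynomial vanishes on. *)
Definition dynamically_admissible (R : realType) (K : fieldType)
    (iota : {rmorphism K -> R}) (n d : nat) (G : rel 'I_n)
    (D : set (state R n d G))
    (eta : state R n d G -> 'M[R]_#|edges G|) : Prop :=
  generically iota (fun p : 'M[R]_(n, d) =>
    D (p, distance_map G p) ->
    hyperbolic_on (rigidity_mx G p) (eta (p, distance_map G p))).

(* Main.v *)
Require Import Defs.
From mathcomp Require Import -(notations) mpoly.
From HB Require Import structures.
From mathcomp Require Import all_boot all_order all_algebra.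
From mathcomp Require Import complex.
From mathcomp Require Import all_classical all_reals all_analysis.
From mathcomp Require Import ring lra.

Set Implicit Arguments.
Unset Strict Implicit.
Unset Printing Implicit Defensive.

Import Order.TTheory GRing.Theory Num.Theory.
Import numFieldNormedType.Exports.

Local Open Scope classical_set_scope.
Local Open Scope ring_scope.

(** Let [e = m - m*] be the measurement error, [T] the column space of the
    rigidity matrix at the target, and [eta*] the value of [eta] there.

    At a stable target every eigenvalue of [eta*] on [T] has positive real part
    ([exp_stable_spectrum]).  Along a trajectory [e' = - eta e], a linear
    equation whose coefficient is close to [- eta*] for as long as [p] is close
    to [p*].  If some eigenvalue on [T] had real part [<= 0], then for a
    suitable [a] strictly between [0] and the decay rate [c], the matrix
    [A = a - eta*] would have an eigenvalue of positive real part on [T] and no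
    two eigenvalues with sum zero.  The second property makes the Lyapunov
    equation [P A + A^T P = 1] solvable; testing the equation on a complex
    eigenvector yields a real [v] in [T] with [v^T P v > 0]
    ([lyapunov_unstable]).  Near the target, [exp (2 a t) e^T P e] is
    nondecreasing, hence stays positive if it starts positive, which
    contradicts [|e| <= C exp (- c t)] with [a < c] ([lyapunov_decay]).  The
    trajectory starts at [p* + s w] for a small [s] and a [w] that the rigidity
    matrix sends to [v] ([start_near]); this is an admissible start because the
    regular points form an open set ([regular_point_near]).  It remains near
    [p*]: up to a fixed time by Gronwall's inequality, and afterwards because
    the exponential convergence of [p] leaves it little distance to travel
    ([solution_stays]).

    For real matrices, the condition that no two eigenvalues (equal ones
    included) have sum zero lies between the two spectral properties at stake:
    it holds if all real parts are positive, and it excludes imaginary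
    eigenvalues, because these come with their conjugates.  Unlike
    hyperbolicity it is algebraic: it amounts to [h(X)] and [h(-X)] being
    coprime, where [h] is the characteristic polynomial of the restriction to
    [T].  As the range of [eta] is contained in [T], the polynomial [h] is that
    of [eta] itself divided by a power of [X], and the condition becomes
    [det (h(- eta)) != 0] ([det_horner_compN_neq0]).  With the denominators
    cleared and [m = F(p)] substituted, this determinant is a polynomial in [p]
    with coefficients in [K] ([spectrum_polynomial]).  It does not vanish at
    the stable target, so it is nonzero on an open dense set
    ([generically_neq0]), where [eta] is hyperbolic. *)

(** * Complex spectra and the Lyapunov equation *)

Lemma exists_notin (R : realFieldType) (s : seq R) (a b : R) :
  a < b -> exists2 x, a < x < b & x \notin s.
Proof.
elim: s b => [|y s IH] b ab.
  by exists ((a + b) / 2); rewrite ?midf_lt// in_nil.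
have [ya|ay] := leP y a.
  have [x /andP[ax xb] xs] := IH b ab; exists x; first by rewrite ax.
  by rewrite inE negb_or xs andbT gt_eqF// (le_lt_trans ya).
have [|x /andP[ax xm] xs] := IH (Num.min y b); first by rewrite lt_min ay.
move: xm; rewrite lt_min => /andP[xy xb].
exists x; first by rewrite ax.
by rewrite inE negb_or xs andbT lt_eqF.
Qed.

(** Two block triangular eliminations of the matrix with rows [(X, A)] and
    [(B, 1)]. *)
Lemma char_poly_mulC (R : comNzRingType) (m n : nat)
    (A : 'M[R]_(m, n)) (B : 'M[R]_(n, m)) :
  'X^n * char_poly (A *m B) = 'X^m * char_poly (B *m A).
Proof.
pose A' := map_mx polyC A; pose B' := map_mx polyC B.
pose M := block_mx ('X%:M : 'M[{poly R}]_m) A' B' (1%:M : 'M[{poly R}]_n).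
have E1 : block_mx (1%:M : 'M[{poly R}]_m) (- A') 0 1%:M *m M =
    block_mx ('X%:M - A' *m B') 0 B' 1%:M.
  rewrite /M mulmx_block !mul1mx !mul0mx mulmx1 addrN !add0r.
  by rewrite mulNmx.
have E2 : block_mx (1%:M : 'M[{poly R}]_m) 0 (- B') 'X%:M *m M =
    block_mx 'X%:M A' 0 ('X%:M - B' *m A').
  rewrite /M mulmx_block !mul1mx !mul0mx mulmx1 !addr0 mulNmx.
  by rewrite -scalar_mxC addNr mulNmx addrC.
have := congr1 determinant E1; have := congr1 determinant E2.
rewrite !det_mulmx det_ublock det_lblock !det1 !mul1r det_lblock det_ublock.
rewrite !det1 !mul1r !mulr1 !det_scalar => + E4; rewrite E4.
have H (p q : nat) (C : 'M[R]_(p, q)) (D : 'M[R]_(q, p)) :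
    'X%:M - map_mx polyC C *m map_mx polyC D = char_poly_mx (C *m D).
  by rewrite /char_poly_mx map_mxM.
by rewrite !H.
Qed.

Lemma coprime_char_poly_unit (F : fieldType) (n : nat) (A : 'M[F]_n.+1)
    (g : {poly F}) :
  coprimep (char_poly A) g -> horner_mx A g \in unitmx.
Proof.
move=> /Bezout_eq1_coprimepP[[u v] /= E].
have := congr1 (horner_mx A) E.
rewrite rmorphD !rmorphM rmorph1 /= Cayley_Hamilton mulr0 add0r => H.
by have [] := mulmx1_unit H.
Qed.

Definition cplx_roots (R : rcfType) (p : {poly R}) : pred R[i] :=
  root (map_poly (real_complex R) p).

Lemma coprimep_cplx_roots (R : rcfType) (p q : {poly R}) :
  (forall z, cplx_roots p z -> ~~ cplx_roots q z) -> coprimep p q.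
Proof.
move=> H; rewrite -(coprimep_map (real_complex R)) coprimep_def.
apply/negPn/negP => /closed_rootP[z]; rewrite root_gcd => /andP[pz qz].
by have /negP := H _ pz; apply.
Qed.

Lemma cplx_roots_compN (R : rcfType) (p : {poly R}) z :
  cplx_roots (p \Po - 'X) z = cplx_roots p (- z).
Proof.
rewrite /cplx_roots map_comp_poly rmorphN/= map_polyX /root horner_comp.
by rewrite hornerN hornerX.
Qed.

Lemma char_poly_tr (R : comNzRingType) n (A : 'M[R]_n) :
  char_poly A^T = char_poly A.
Proof.
rewrite /char_poly -[RHS]det_tr; congr (\det _).
by rewrite /char_poly_mx linearB/= tr_scalar_mx map_trmx.
Qed.

Lemma char_polyN (R : comNzRingType) n (A : 'M[R]_n) :
  char_poly (- A) = (-1) ^+ n *: (char_poly A \Po - 'X).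
Proof.
rewrite /char_poly -det_map_mx -mul_polyC rmorphXn/= rmorphN1 -detZ.
congr (\det _); apply/matrixP => i j; rewrite !mxE.
rewrite rmorphB/= !polyCN rmorphMn/= comp_polyX comp_polyC mulN1r opprB.
by rewrite opprK mulNrn opprK addrC.
Qed.

(** A solution [X] of the homogeneous equation intertwines [A] and [- A^T], so
    that [chi_A (- A^T) X = X chi_A (A) = 0], and [chi_A (- A^T)] is invertible
    because [chi_A] is coprime to the characteristic polynomial of [- A^T].
    Thus the Lyapunov operator is injective, hence onto; by uniqueness the
    solution is symmetric. *)
Lemma lyapunov_solution (R : rcfType) (n : nat) (A : 'M[R]_n) :
  (forall z w, cplx_roots (char_poly A) z -> cplx_roots (char_poly A) w ->
     z + w != 0) ->
  exists2 P : 'M[R]_n, P^T = P & P *m A + A^T *m P = 1%:M.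
Proof.
case: n A => [|n] A noroots.
  by exists 0; apply/matrixP => -[].
have inj (X : 'M[R]_n.+1) : X *m A + A^T *m X = 0 -> X = 0.
  move=> /eqP; rewrite addr_eq0 -mulNmx => /eqP XA.
  have XpA p : X *m horner_mx A p = horner_mx (- A^T) p *m X.
    elim/poly_ind: p => [|p c IH]; first by rewrite !rmorph0 mulmx0 mul0mx.
    rewrite !rmorphD !rmorphM /= !horner_mx_X !horner_mx_C mulmxDr mulmxDl.
    by rewrite -!mulmxE -mulmxA -XA !mulmxA IH scalar_mxC.
  have := XpA (char_poly A); rewrite Cayley_Hamilton mulmx0.
  have U : horner_mx (- A^T) (char_poly A) \in unitmx.
    apply: coprime_char_poly_unit; rewrite char_polyN char_poly_tr.
    rewrite coprimepZl ?signr_eq0//; apply: coprimep_cplx_roots => z.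
    rewrite cplx_roots_compN => rz; apply/negP => rz'.
    by have := noroots _ _ rz rz'; rewrite addNr eqxx.
  by move=> /(congr1 (mulmx (invmx (horner_mx (- A^T) (char_poly A)))));
     rewrite mulmx0 mulKmx.
pose L : 'M[R]_(n.+1 * n.+1) := lin_mulmxr A + lin_mulmx A^T.
have LE X : mxvec X *m L = mxvec (X *m A + A^T *m X).
  by rewrite mulmxDr !mul_vec_lin linearD.
have Lu : L \in unitmx.
  rewrite -row_free_unit; apply: inj_row_free => v vL.
  have Lv := LE (vec_mx v); rewrite vec_mxK vL in Lv.
  have v0 : vec_mx v = 0 by apply/inj/(can_inj mxvecK); rewrite -Lv linear0.
  by rewrite -[v]vec_mxK v0 linear0.
pose P := vec_mx (mxvec 1%:M *m invmx L).
have PE : P *m A + A^T *m P = 1%:M.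
  by apply: (can_inj mxvecK); rewrite -LE vec_mxK mulmxKV.
exists P => //.
apply/eqP; rewrite -subr_eq0; apply/eqP/inj.
rewrite mulmxBl mulmxBr addrACA -opprD PE.
have : (P *m A + A^T *m P)^T = 1%:M by rewrite PE trmx1.
by rewrite linearD/= !trmx_mul trmxK [A^T *m _ + _]addrC => ->; rewrite subrr.
Qed.

Definition sums_nonzero (R : rcfType) (p : {poly R}) : Prop :=
  forall z w, cplx_roots p z -> cplx_roots p w -> z + w != 0.

(** The factor [X^k] is harmless: if [0] is a root of [h], then [0 + 0] is
    already a vanishing sum of two roots of [h]. *)
Lemma det_horner_compN_neq0 (R : rcfType) (N k : nat) (A : 'M[R]_N.+1)
    (h : {poly R}) :
  char_poly A = 'X^k * h ->
  \det (horner_mx A (h \Po - 'X)) != 0 <-> sums_nonzero h.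
Proof.
move=> chiA; have root_chi z : cplx_roots (char_poly A) z =
    cplx_roots 'X^k z || cplx_roots h z.
  by rewrite chiA /cplx_roots rmorphM rootM.
split=> [|H].
  move=> + z w hz hw; apply: contraNneq => /eqP.
  rewrite addr_eq0 => /eqP zw.
  rewrite -(fmorph_eq0 (real_complex R)) -det_map_mx map_horner_mx.
  have : root (char_poly (map_mx (real_complex R) A)) z.
    by rewrite -map_char_poly; have := root_chi z; rewrite hz orbT.
  rewrite -eigenvalue_root_char => /eigenvalueP[v vA v0].
  have : cplx_roots (h \Po - 'X) z.
    by rewrite cplx_roots_compN zw opprK.
  rewrite /cplx_roots => /factor_theorem[q ->].
  apply/det0P; exists v => //.
  rewrite mulrC rmorphM/= rmorphB/= horner_mx_X horner_mx_C.
  by rewrite -mulmxE mulmxA mulmxBr vA mul_mx_scalar subrr mul0mx.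
rewrite -unitfE -unitmxE; apply: coprime_char_poly_unit.
apply: coprimep_cplx_roots => z; rewrite root_chi cplx_roots_compN.
case/orP => [|hz]; last first.
  by apply/negP => /(H _ _ hz); rewrite subrr eqxx.
rewrite /cplx_roots map_polyXn /root hornerXn expf_eq0 => /andP[_ /eqP->].
by rewrite oppr0; apply/negP => h0; have := H _ _ h0 h0; rewrite addr0 eqxx.
Qed.

(** The single element [f] serves for all evaluations [phi] of the matrix at
    which it factors through [r] dimensions: all these specializations share
    the multiplicity [N - r] that is divided out of the characteristic
    polynomial.  The product [V *m Y] is the matrix of the operator restricted
    to the row space of [V]. *)
Lemma sums_nonzero_polynomial (S : comNzRingType) (N r : nat) (A : 'M[S]_N) :
  (r <= N)%N ->
  exists f : S, forall (R : rcfType) (phi : {rmorphism S -> R}) (r' : nat)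
      (Y : 'M[R]_(N, r')) (V : 'M[R]_(r', N)),
    r' = r -> map_mx phi A = Y *m V ->
    phi f != 0 <-> sums_nonzero (char_poly (V *m Y)).
Proof.
case: N A => [|N] A rN.
  exists 1 => R phi r' Y V r'E _;
  rewrite {r'}r'E in Y V *; rewrite rmorph1 oner_eq0; split => // _ z w.
  move: rN; rewrite leqn0 => /eqP r0.
  rewrite /cplx_roots; move: Y V; rewrite r0 => Y V.
  by rewrite /char_poly det_mx00 rmorph1 (negbTE (root1 _)).
pose h := drop_poly (N.+1 - r) (char_poly A).
exists (\det (horner_mx A (h \Po - 'X))) => R phi r' Y V r'E AYV.
rewrite {r'}r'E in Y V AYV *.
have chiA : char_poly (map_mx phi A) = 'X^(N.+1 - r) * char_poly (V *m Y).
  have XN : 'X^(N.+1) = 'X^r * 'X^(N.+1 - r) :> {poly R}.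
    by rewrite -exprD subnKC.
  rewrite AYV; have := char_poly_mulC Y V; rewrite XN -mulrA.
  by apply: mulfI; rewrite -size_poly_gt0 size_polyXn.
rewrite -det_map_mx map_horner_mx map_comp_poly rmorphN/= map_polyX.
have -> : map_poly phi h = char_poly (V *m Y).
  have -> : map_poly phi h = drop_poly (N.+1 - r) (map_poly phi (char_poly A)).
    by apply/polyP => i; rewrite coef_map !coef_drop_poly coef_map.
  by rewrite map_char_poly chiA mulrC drop_polyMXn_id.
exact: det_horner_compN_neq0 chiA.
Qed.

Lemma sums_nonzero_imaginary (R : rcfType) (p : {poly R}) z :
  sums_nonzero p -> cplx_roots p z -> complex.Re z != 0.
Proof.
move=> H pz; have pz' : cplx_roots p (conjc z).
  move: pz; rewrite /cplx_roots /root.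
  rewrite -(fmorph_eq0 conjc) -horner_map -map_poly_comp/=.
  set a := map_poly _ _; set b := map_poly _ _ => /eqP E.
  rewrite (_ : b = a) ?E//; apply: eq_map_poly => x /=.
  by rewrite /real_complex_def/= oppr0.
apply: contraNneq (H _ _ pz pz'); case: z {pz pz'} => [x y] /= ->.
by apply/eqP/eqP; rewrite eq_complex /= addr0 subrr eqxx.
Qed.

Lemma sums_nonzero_pos (R : rcfType) (p : {poly R}) :
  (forall z, cplx_roots p z -> 0 < complex.Re z) -> sums_nonzero p.
Proof.
move=> H z w /H + /H; case: z w => [a b] [c d] /= a0 c0.
by rewrite eq_complex negb_and /= gt_eqF// addr_gt0.
Qed.

Lemma map_Re_mulmx (R : rcfType) m n q (x : 'M[R[i]]_(m, n)) (M : 'M[R]_(n, q)) :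
  map_mx (@complex.Re R) (x *m map_mx (real_complex R) M) =
  map_mx (@complex.Re R) x *m M.
Proof.
apply/matrixP => i j; rewrite !mxE raddf_sum; apply: eq_bigr => k _.
by rewrite !mxE; case: (x i k) => a b /=; rewrite mulr0 subr0.
Qed.

Lemma map_Im_mulmx (R : rcfType) m n q (x : 'M[R[i]]_(m, n)) (M : 'M[R]_(n, q)) :
  map_mx (@complex.Im R) (x *m map_mx (real_complex R) M) =
  map_mx (@complex.Im R) x *m M.
Proof.
apply/matrixP => i j; rewrite !mxE raddf_sum; apply: eq_bigr => k _.
by rewrite !mxE; case: (x i k) => a b /=; rewrite mulr0 add0r.
Qed.

Lemma cplx_roots_char_poly_shift (R : rcfType) n (B : 'M[R]_n) (a : R) z :
  cplx_roots (char_poly (a%:M - B)) z ->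
  cplx_roots (char_poly B) (a%:C%C - z).
Proof.
rewrite /cplx_roots !map_char_poly -!eigenvalue_root_char.
move=> /eigenvalueP[v vA v0]; apply/eigenvalueP; exists v => //.
move: vA; rewrite map_mxB map_scalar_mx/= mulmxBr mul_mx_scalar => vA.
by rewrite scalerBl -vA opprB addrC subrK.
Qed.

(** Shifting by [a] moves each pairwise sum of eigenvalues by [2 a], so only
    finitely many [a] are excluded. *)
Lemma sums_nonzero_shift (R : rcfType) n (B : 'M[R]_n) (c : R) : 0 < c ->
  exists2 a, 0 < a < c & sums_nonzero (char_poly (a%:M - B)).
Proof.
move=> c0; have [s sP] := closed_field_poly_normal
  (map_poly (real_complex R) (char_poly B)).
have roots_s z : cplx_roots (char_poly B) z -> z \in s.
  rewrite /cplx_roots sP rootZ ?root_prod_XsubC//.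
  by rewrite lead_coef_eq0 map_poly_eq0 monic_neq0// char_poly_monic.
pose l := [seq (complex.Re z + complex.Re w) / 2 | z <- s, w <- s].
have [a a0c al] := exists_notin l c0; exists a => // z w.
move=> /cplx_roots_char_poly_shift/roots_s zs
  /cplx_roots_char_poly_shift/roots_s ws.
apply: contra al => /eqP zw; apply/allpairsP.
exists (a%:C%C - z, a%:C%C - w); split => //=.
move: zw; case: z {zs} => z1 z2; case: w {ws} => w1 w2 /= [+ _].
by lra.
Qed.

(** [a - B] has on the row space of [V] an eigenvalue of real part at least
    [a > 0].  For its eigenvector [u1 + i u2], the Lyapunov equation gives
    [2 (a - Re z) (q u1 + q u2) = |u1|^2 + |u2|^2], where [q] is the quadratic
    form of [P]; so [q] is positive at [u1] or at [u2]. *)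
Lemma lyapunov_unstable (R : rcfType) (N r : nat) (B : 'M[R]_N)
    (Y : 'M[R]_(N, r)) (V : 'M[R]_(r, N)) z c :
  B^T = Y *m V -> row_free V -> cplx_roots (char_poly (V *m Y)) z ->
  complex.Re z <= 0 -> 0 < c ->
  exists (a : R) (P : 'M[R]_N) (y : 'rV[R]_r),
    [/\ 0 < a < c, P^T = P,
        P *m (a%:M - B) + (a%:M - B)^T *m P = 1%:M &
        0 < (y *m V *m P *m (y *m V)^T) 0 0].
Proof.
move=> BYV Vfree hz z0 c0.
have [a ac sumsA] := sums_nonzero_shift B c0.
have [P Psym PE] := lyapunov_solution sumsA.
suff [y y0] : exists y : 'rV[R]_r, 0 < (y *m V *m P *m (y *m V)^T) 0 0.
  by exists a, P, y.
move: hz; rewrite /cplx_roots map_char_poly -eigenvalue_root_char.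
move=> /eigenvalueP[x]; rewrite map_mxM; set V' := map_mx _ V => xE x0.
pose x1 := map_mx (@complex.Re R) x; pose x2 := map_mx (@complex.Im R) x.
have x1E : x1 *m (V *m Y) = complex.Re z *: x1 - complex.Im z *: x2.
  rewrite -map_Re_mulmx map_mxM xE; apply/matrixP => i j; rewrite !mxE.
  by case: z {z0 xE} => z1 z2; case: (x i j).
have x2E : x2 *m (V *m Y) = complex.Re z *: x2 + complex.Im z *: x1.
  rewrite -map_Im_mulmx map_mxM xE; apply/matrixP => i j; rewrite !mxE.
  by case: z {z0 xE x1E} => z1 z2; case: (x i j) => ? ? /=; rewrite addrC.
pose u1 := x1 *m V; pose u2 := x2 *m V.
pose q (u v : 'rV[R]_N) := (u *m P *m v^T) 0 0.
have qC u v : q u v = q v u.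
  have E : (u *m P *m v^T)^T = v *m P *m u^T.
    by rewrite !trmx_mul trmxK Psym mulmxA.
  by rewrite /q -E [RHS]mxE.
have q2E u : q u (u *m (a%:M - B)^T) *+ 2 = (u *m u^T) 0 0.
  rewrite -{3}[u]mulmx1 -PE mulmxDr mulmxDl [RHS]mxE mulr2n {2}qC.
  by rewrite /q trmx_mul trmxK !mulmxA.
have uA t : t *m V *m (a%:M - B)^T = a *: (t *m V) - t *m (V *m Y) *m V.
  by rewrite linearB/= tr_scalar_mx mulmxBr mul_mx_scalar BYV !mulmxA.
have u1A : u1 *m (a%:M - B)^T = (a - complex.Re z) *: u1 + complex.Im z *: u2.
  rewrite uA x1E mulmxBl -!scalemxAl scalerBl opprB addrA addrAC.
  by rewrite -/u1 -/u2 -addrA [X in _ + X]addrC addrA.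
have u2A : u2 *m (a%:M - B)^T = (a - complex.Re z) *: u2 - complex.Im z *: u1.
  by rewrite uA x2E mulmxDl -!scalemxAl scalerBl opprD addrA.
have qDZ u k v l w : q u (k *: v + l *: w) = k * q u v + l * q u w.
  by rewrite /q linearD !linearZ/= mulmxDr -!scalemxAr !mxE.
have sq (u : 'rV[R]_N) : (u *m u^T) 0 0 = \sum_i u 0 i ^+ 2.
  by rewrite mxE; apply: eq_bigr => i _; rewrite mxE expr2.
have sqge (u : 'rV[R]_N) : 0 <= (u *m u^T) 0 0.
  by rewrite sq; apply: sumr_ge0 => i _; exact: sqr_ge0.
have sq0 (u : 'rV[R]_N) : (u *m u^T) 0 0 = 0 -> u = 0.
  rewrite sq => /psumr_eq0P H; apply/rowP => i; rewrite mxE; apply/eqP.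
  by rewrite -sqrf_eq0 H// => j _; exact: sqr_ge0.
have sumE : (q u1 u1 + q u2 u2) * ((a - complex.Re z) *+ 2) =
    (u1 *m u1^T) 0 0 + (u2 *m u2^T) 0 0.
  rewrite -!q2E u1A u2A -scaleNr !qDZ (qC u2 u1); ring.
have pos : 0 < (u1 *m u1^T) 0 0 + (u2 *m u2^T) 0 0.
  rewrite lt_def addr_ge0// andbT paddr_eq0//.
  apply: contra x0 => /andP[/eqP/sq0 + /eqP/sq0].
  have Vinj (t : 'rV[R]_r) : t *m V = 0 -> t = 0.
    by move=> tV; apply: (row_free_inj Vfree); rewrite tV mul0mx.
  move=> /Vinj x10 /Vinj x20; apply/eqP/rowP => i.
  have := congr1 (fun M : 'rV[R]_r => M 0 i) x10.
  have := congr1 (fun M : 'rV[R]_r => M 0 i) x20.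
  by rewrite !mxE; case: (x 0 i) => ? ? /= -> ->.
have [q1|q1] := ltP 0 (q u1 u1); first by exists x1.
have [q2|q2] := ltP 0 (q u2 u2); first by exists x2.
have : (q u1 u1 + q u2 u2) * ((a - complex.Re z) *+ 2) <= 0.
  case/andP: ac => a0 _; apply: mulr_le0_ge0; lra.
by rewrite sumE leNgt pos.
Qed.

Lemma finite_roots (R : rcfType) (g : {poly R}) : g != 0 ->
  exists r : seq R, forall s, root g s -> s \in r.
Proof.
move=> g0; have [s sP] := closed_field_poly_normal (map_poly (real_complex R) g).
exists [seq complex.Re z | z <- s] => x gx; apply/mapP; exists x%:C%C => //.
move: gx; rewrite -(fmorph_root (real_complex R)) sP rootZ ?root_prod_XsubC//.
by rewrite lead_coef_eq0 map_poly_eq0.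
Qed.

Lemma sums_nonzero_char_polyZ (R : rcfType) n (M : 'M[R]_n) (a : R) :
  a != 0 -> sums_nonzero (char_poly M) -> sums_nonzero (char_poly (a *: M)).
Proof.
move=> a0 H; have ac0 : a%:C%C != 0 by rewrite fmorph_eq0.
suff root_scale z : cplx_roots (char_poly (a *: M)) z ->
    cplx_roots (char_poly M) (a%:C%C^-1 * z).
  move=> z w /root_scale Hz /root_scale Hw; have := H _ _ Hz Hw.
  by rewrite -mulrDr mulf_eq0 invr_eq0 (negbTE ac0).
rewrite /cplx_roots !map_char_poly -!eigenvalue_root_char.
move=> /eigenvalueP[v vM v0]; apply/eigenvalueP; exists v => //.
by rewrite -scalerA -vM map_mxZ /= -scalemxAr scalerA mulVf// scale1r.
Qed.

(** * Limits of matrices and polynomials, generic sets *)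

Section Limits.
Context (R : realType) (T : Type) (F : set_system T) {FF : Filter F}.

Lemma cvg_bigsum (I : Type) (r : seq I) (P : pred I) (f : I -> T -> R)
    (l : I -> R) :
  (forall i, P i -> f i x @[x --> F] --> l i) ->
  \sum_(i <- r | P i) f i x @[x --> F] --> \sum_(i <- r | P i) l i.
Proof. by move=> fl; apply: cvg_big fl; exact: add_continuous. Qed.

Lemma cvg_bigprod (I : Type) (r : seq I) (P : pred I) (f : I -> T -> R)
    (l : I -> R) :
  (forall i, P i -> f i x @[x --> F] --> l i) ->
  \prod_(i <- r | P i) f i x @[x --> F] --> \prod_(i <- r | P i) l i.
Proof. by move=> fl; apply: cvg_big fl; exact: mul_continuous. Qed.

Lemma cvg_expr (f : T -> R) (l : R) k :
  f x @[x --> F] --> l -> f x ^+ k @[x --> F] --> l ^+ k.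
Proof. by move=> fl; exact: (cvg_comp _ _ fl (@exprn_continuous R k l)). Qed.

Lemma cvg_entries m n (f : T -> 'M[R]_(m, n)) (l : 'M[R]_(m, n)) :
  (forall i j, f x i j @[x --> F] --> l i j) -> f x @[x --> F] --> l.
Proof.
move=> fl; apply/cvg_ballP => e e0.
have : \forall x \near F, forall ij : 'I_m * 'I_n,
    ball (l ij.1 ij.2) e (f x ij.1 ij.2).
  by apply: filter_forall => -[i j] /=; move/cvg_ballP : (fl i j); exact.
by apply: filterS => x H; split=> // i j; exact: (H (i, j)).
Qed.

Lemma cvg_entry m n (f : T -> 'M[R]_(m, n)) (l : 'M[R]_(m, n)) i j :
  f x @[x --> F] --> l -> f x i j @[x --> F] --> l i j.
Proof.
by move=> fl; exact: (cvg_comp _ _ fl (@coord_continuous R m n i j l)).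
Qed.

Lemma cvg_mulmx m n q (f : T -> 'M[R]_(m, n)) (g : T -> 'M[R]_(n, q))
    (k : 'M[R]_(m, n)) (l : 'M[R]_(n, q)) :
  f x @[x --> F] --> k -> g x @[x --> F] --> l ->
  f x *m g x @[x --> F] --> k *m l.
Proof.
move=> fk gl; apply: cvg_entries => i j; under eq_fun do rewrite mxE.
rewrite mxE; apply: cvg_bigsum => h _.
by apply: cvgM; exact: cvg_entry.
Qed.

Lemma cvg_trmx m n (f : T -> 'M[R]_(m, n)) (l : 'M[R]_(m, n)) :
  f x @[x --> F] --> l -> (f x)^T @[x --> F] --> l^T.
Proof.
move=> fl; apply: cvg_entries => i j; under eq_fun do rewrite mxE.
by rewrite mxE; exact: cvg_entry.
Qed.

Lemma cvg_det n (f : T -> 'M[R]_n) (l : 'M[R]_n) :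
  f x @[x --> F] --> l -> \det (f x) @[x --> F] --> \det l.
Proof.
move=> fl; rewrite /determinant; apply: cvg_bigsum => s _.
apply: cvgM; first exact: cvg_cst.
by apply: cvg_bigprod => i _; exact: cvg_entry.
Qed.

Lemma cvg_mxvec m n (f : T -> 'M[R]_(m, n)) (l : 'M[R]_(m, n)) :
  f x @[x --> F] --> l -> mxvec (f x) @[x --> F] --> mxvec l.
Proof.
move=> fl; apply: cvg_entries => i j; rewrite ord1.
case/mxvec_indexP: j => a b; under eq_fun do rewrite mxvecE.
by rewrite mxvecE; exact: cvg_entry.
Qed.

Lemma cvg_peval (K : fieldType) (iota : {rmorphism K -> R}) N
    (g : mpoly N K) (f : T -> 'rV[R]_N) (l : 'rV[R]_N) :
  f x @[x --> F] --> l -> peval iota g (f x) @[x --> F] --> peval iota g l.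
Proof.
move=> fl; rewrite /peval /mmap; apply: cvg_bigsum => m _.
apply: cvgM; first exact: cvg_cst.
by apply: cvg_bigprod => i _; apply: cvg_expr; exact: cvg_entry.
Qed.

End Limits.

Section Peval.
Context (R : realType) (K : fieldType) (iota : {rmorphism K -> R}).

Definition peval_rmorphism N (x : 'rV[R]_N) : {rmorphism mpoly N K -> R} :=
  mmap iota (fun k => x 0 k).

Lemma pevalE N (x : 'rV[R]_N) (f : mpoly N K) :
  peval iota f x = peval_rmorphism x f.
Proof. by []. Qed.

Lemma peval_line N (f : mpoly N K) (x y : 'rV[R]_N) :
  exists g : {poly R}, forall s, g.[s] = peval iota f (x + s *: y).
Proof.
exists (mmap (polyC \o iota) (fun k => (x 0 k)%:P + (y 0 k) *: 'X) f) => s.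
rewrite /peval /mmap horner_sum; apply: eq_bigr => m _.
rewrite hornerM /= hornerC /mmap1 horner_prod; congr (_ * _).
apply: eq_bigr => i _; rewrite horner_exp; congr (_ ^+ _).
by rewrite !hornerE !mxE mulrC.
Qed.

Lemma zero_locus1 n d (f : mpoly (n * d) K) (p : 'M[R]_(n, d)) :
  ~ zero_locus iota [:: f] p <-> peval iota f (mxvec p) != 0.
Proof.
rewrite /zero_locus /= andbT; split=> [/negP//|f0]; exact/negP.
Qed.

Lemma continuous_peval n d (f : mpoly (n * d) K) :
  continuous (fun p : 'M[R]_(n, d) => peval iota f (mxvec p)).
Proof.
move=> p; apply: (@cvg_peval _ _ (nbhs p)).
by apply: (@cvg_mxvec _ _ (nbhs p) _ _ _ id); exact: cvg_id.
Qed.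

(** Density is seen on the line from [p] to a point of the given open set: on
    it, [f] is a univariate polynomial with a nonzero value, so it has only
    finitely many zeros. *)
Lemma generically_neq0 n d (f : mpoly (n * d) K) (p : 'M[R]_(n, d))
    (P : 'M[R]_(n, d) -> Prop) :
  peval iota f (mxvec p) != 0 ->
  (forall q, peval iota f (mxvec q) != 0 -> P q) ->
  generically iota P.
Proof.
move=> fp fP; exists [:: f]; split; last by move=> q /zero_locus1/fP.
- rewrite openE => q /zero_locus1 fq.
  have : \forall r \near q, peval iota f (mxvec r) != 0.
    have := @continuous_peval n d f q.
    by move/cvgr_neq0; exact.
  by apply: filterS => r /zero_locus1.
- move=> O [q Oq] Oopen.
  have [g gE] := peval_line f (mxvec p) (mxvec (q - p)).
  have g0 : g != 0.
    apply: contraNneq fp => g0; have := gE 0.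
    by rewrite g0 horner0 scale0r addr0 => <-.
  pose c (s : R) := p + s *: (q - p).
  have : \forall s \near (1 : R), O (c s).
    have cc : c s @[s --> (1 : R)] --> q.
      have -> : q = c 1 by rewrite /c scale1r addrC subrK.
      apply: cvg_entries => i j; under eq_fun do rewrite !mxE.
      rewrite !mxE; apply: cvgD; first exact: cvg_cst.
      by apply: cvgM; [exact: cvg_id|exact: cvg_cst].
    by apply: cc; exact: open_nbhs_nbhs.
  move=> /nbhs_ballP[e /= e0 eO].
  have [s /andP[s1 se] gs] : exists2 s, 1 < s < 1 + e & ~~ root g s.
    have [r rP] := finite_roots g0.
    have [|s s1 sr] := @exists_notin _ r 1 (1 + e); first by rewrite ltrDl.
    by exists s => //; apply: contra sr => /rP.
  exists (c s); split.
    by apply: eO; rewrite /= /ball/= ltr_norml; lra.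
  by apply/zero_locus1; move: gs; rewrite /root gE /c [p + _]addrC linearP addrC.
Qed.

Lemma distance_mapE n d (G : rel 'I_n) (p : 'M[R]_(n, d)) k :
  distance_map G p k 0 =
  \sum_c (p (enum_val k).2 c - p (enum_val k).1 c) ^+ 2.
Proof.
rewrite mxE; case: (enum_val k) => i j /=.
rewrite /enorm big_ord1 sqr_sqrtr; last by apply: sumr_ge0 => c _; exact: sqr_ge0.
by apply: eq_bigr => c _; rewrite !mxE.
Qed.

(** Substituting [m = F(p)] turns a polynomial in the state into a polynomial
    in the configuration, with the same field of coefficients. *)
Lemma peval_graph n d (G : rel 'I_n) (g : mpoly (n * d + #|edges G|) K) :
  exists f : mpoly (n * d) K, forall p : 'M[R]_(n, d),
    peval iota f (mxvec p) =
    peval iota g (row_mx (mxvec p) (distance_map G p)^T).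
Proof.
pose X i c : mpoly (n * d) K := mpolyX K (mnm1 (mxvec_index i c)).
pose D (k : 'I_#|edges G|) : mpoly (n * d) K :=
  \sum_c (X (enum_val k).2 c - X (enum_val k).1 c) ^+ 2.
pose h (k : 'I_(n * d + #|edges G|)) : mpoly (n * d) K :=
  match fintype.split k with inl a => mpolyX K (mnm1 a) | inr k => D k end.
exists (mmap (@mpolyC (n * d) K) h g) => p.
have evX a : peval_rmorphism (mxvec p) (mpolyX K (mnm1 a)) = mxvec p 0 a.
  by rewrite /peval_rmorphism /= mmapX mmap1U.
rewrite pevalE rmorph_sum /peval /mmap; apply: eq_bigr => m _.
rewrite rmorphM /= mmapC; congr (_ * _).
rewrite /mmap1 -/(mmap _ _ _) -[LHS]/(peval_rmorphism (mxvec p) _) rmorph_prod.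
apply: eq_bigr => k _; rewrite rmorphXn; congr (_ ^+ _).
rewrite /h mxE; case: fintype.split => a; first exact: evX.
rewrite mxE distance_mapE rmorph_sum; apply: eq_bigr => c _.
by rewrite rmorphXn rmorphB !evX !mxvecE.
Qed.

End Peval.

(** * Quadratic forms along linear differential equations *)

Section Comparison.
Context (R : realType).

(** [f t * expR (- k * t)] is nondecreasing. *)
Lemma expR_comparison (f f' : R -> R) (k T : R) : 0 <= T ->
  {within `[0, T], continuous f} ->
  (forall t, 0 < t < T -> is_derive t 1 f (f' t)) ->
  (forall t, 0 < t < T -> k * f t <= f' t) ->
  f 0 * expR (k * T) <= f T.
Proof.
rewrite le_eqVlt => /predU1P[<- _ _ _|T0 fc fd kf].
  by rewrite mulr0 expR0 mulr1.
pose g t := f t * expR (- k * t).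
pose g' t := (f' t - k * f t) * expR (- k * t).
have ed (t : R) : is_derive t 1 (fun t => expR (- k * t)) (expR (- k * t) * (- k)).
  have kd : is_derive t 1 ( *%R (- k)) (- k).
    have := @is_deriveZ _ _ _ id (- k) t 1 1 (is_derive_id _ _).
    by rewrite /GRing.scale/= mulr1; exact.
  exact: (@is_derive1_comp _ expR ( *%R (- k)) t _ _ (is_derive_expR _) kd).
have gd t : t \in `]0, T[ -> is_derive t 1 g (g' t).
  rewrite in_itv/= => /fd fdt; apply: (is_derive_eq (is_deriveM fdt (ed t))).
  by rewrite /g' /GRing.scale/=; ring.
have gc : {within `[0, T], continuous g}.
  move=> t; apply: (@continuousM _ (subspace `[0, T]) f
    (fun t : R => expR (- k * t))); first exact: fc.
  have : continuous (fun t : R => expR (- k * t)).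
    move=> s; apply: differentiable_continuous; apply/derivable1_diffP.
    by have [] := ed s.
  by move/continuous_subspaceT; exact.
have [c + gE] := MVT T0 gd gc.
rewrite in_itv/= => c0T.
have : 0 <= g T - g 0.
  by rewrite gE subr0 mulr_ge0 ?(ltW T0)// mulr_ge0 ?expR_ge0// subr_ge0 kf.
rewrite subr_ge0 /g mulr0 expR0 mulr1 mulNr expRN => H.
by rewrite -ler_pdivlMr ?expR_gt0.
Qed.

(** Continuous induction: [u] stays below [a] provided that it cannot reach [a]
    for the first time.  It is used to exploit estimates that are valid only
    while the trajectory is close to the target. *)
Lemma first_exit (u : R -> R) (a T : R) :
  {within `[0, +oo[, continuous u} ->
  (forall s, 0 <= s <= T -> (forall t, 0 <= t < s -> u t < a) -> u s < a) ->
  forall t, 0 <= t <= T -> u t < a.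
Proof.
move=> uc step t /andP[t0 tT]; apply: contrapT => /negP; rewrite -leNgt => ut.
pose S := [set s | 0 <= s <= t /\ a <= u s].
have St : S t by split; rewrite ?t0//=.
have lbS : lbound S 0 by move=> s [/andP[]].
have infS : has_inf S by split; [exists t|exists 0].
pose s := inf S.
have s0 : 0 <= s by apply: lb_le_inf => //; exists t.
have st : s <= t by apply: ge_inf => //; exists 0.
have us : u s < a.
  apply: step => [|r /andP[r0 rs]]; first by rewrite s0 (le_trans st).
  rewrite ltNge; apply/negP => ur.
  have : s <= r.
    apply: ge_inf; first by exists 0.
    by split=> //; rewrite r0 (ltW (lt_le_trans rs st)).
  by rewrite leNgt rs.
have : \forall r \near within `[0, +oo[ (nbhs s), u r < a.
  have us' : u r @[r --> within `[0, +oo[ (nbhs s)] --> u s.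
    by move/subspace_continuousP : uc; apply; rewrite /= in_itv/= s0.
  by move: us => /(cvgr_lt _ us').
rewrite near_withinE => /nbhs_ballP[e /= e0 He].
have [r [/andP[r0 rt] ar] rs] := inf_adherent e0 infS.
have : u r < a; last by rewrite ltNge ar.
have sr : s <= r by apply: ge_inf; [exists 0|split=> //; rewrite r0].
apply: He; last by rewrite /= in_itv/= r0.
by rewrite /ball/= ltr_norml; rewrite -/s in rs; lra.
Qed.

Lemma is_derive_entry m n (f : R -> 'M[R]_(m, n)) (t : R) (v : 'M[R]_(m, n)) i j :
  is_derive t 1 f v -> is_derive t 1 (fun s => f s i j) (v i j).
Proof.
move=> [fd <-]; apply: DeriveDef; first by move/derivable_mxP : fd.
by rewrite derive_mx// mxE.
Qed.

Definition qform N (P : 'M[R]_N) (x : 'cV[R]_N) : R := (x^T *m P *m x) 0 0.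

Lemma qformE N (P : 'M[R]_N) x :
  qform P x = \sum_i \sum_j P i j * (x i 0 * x j 0).
Proof.
rewrite /qform mxE exchange_big; apply: eq_bigr => j _.
rewrite mxE mulr_suml; apply: eq_bigr => i _.
by rewrite mxE mulrCA mulrA.
Qed.

Lemma is_derive_qform N (P A : 'M[R]_N) (x : R -> 'cV[R]_N) (t : R) :
  (forall i, is_derive t 1 (fun s => x s i 0) ((A *m x t) i 0)) ->
  is_derive t 1 (fun s => qform P (x s)) (qform (P *m A + A^T *m P) (x t)).
Proof.
move=> xd.
have -> : (fun s => qform P (x s)) =
    \sum_i \sum_j (P i j \*: ((fun s => x s i 0) * (fun s => x s j 0))).
  apply/funext => s; rewrite qformE fct_sumE; apply: eq_bigr => i _.
  by rewrite fct_sumE; apply: eq_bigr => j _.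
apply: is_derive_eq.
rewrite /qform mulmxDr mulmxDl [RHS]mxE.
have -> : (x t)^T *m (P *m A) *m x t = (x t)^T *m P *m (A *m x t).
  by rewrite !mulmxA.
have -> : (x t)^T *m (A^T *m P) *m x t = (A *m x t)^T *m P *m x t.
  by rewrite trmx_mul !mulmxA.
rewrite ![in RHS]mxE -big_split/=.
under [RHS]eq_bigr => j _.
  rewrite ![(_ *m P) _ _]mxE !mulr_suml -big_split/=.
  over.
rewrite /= exchange_big; apply: eq_bigr => i _; apply: eq_bigr => j _.
by rewrite ![_^T _ _]mxE /GRing.scale/=; ring.
Qed.

Lemma qform_bound N (P : 'M[R]_N) (x : 'cV[R]_N) M :
  (forall i j, `|P i j| <= M) -> `|qform P x| <= M * N%:R * qform 1%:M x.
Proof.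
move=> PM; have sqE : qform 1%:M x = \sum_i x i 0 ^+ 2.
  rewrite qformE; apply: eq_bigr => i _; rewrite (bigD1 i)//= big1 => [|j ji].
    by rewrite !mxE eqxx mul1r addr0 expr2.
  by rewrite mxE eq_sym (negbTE ji) mul0r.
rewrite qformE sqE.
have H i j : `|P i j * (x i 0 * x j 0)| <= M * ((x i 0 ^+ 2 + x j 0 ^+ 2) / 2).
  rewrite normrM; apply: ler_pM => //.
  rewrite ler_norml; have := sqr_ge0 (x i 0 - x j 0).
  have := sqr_ge0 (x i 0 + x j 0); rewrite sqrrB sqrrD => h1 h2.
  by apply/andP; split; lra.
apply: (le_trans (ler_norm_sum _ _ _)).
have -> : M * N%:R * \sum_i x i 0 ^+ 2 =
    \sum_(i < N) \sum_(j < N) M * ((x i 0 ^+ 2 + x j 0 ^+ 2) / 2).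
  set S := \sum_i _.
  transitivity (\sum_(i < N) M * ((x i 0 ^+ 2 *+ N + S) / 2)).
    rewrite -mulr_sumr -mulr_suml big_split/= sumr_const card_ord sumrMnl.
    by rewrite -/S; field.
  apply: eq_bigr => i _.
  by rewrite -mulr_sumr -mulr_suml big_split/= sumr_const card_ord.
apply: ler_sum => i _; apply: (le_trans (ler_norm_sum _ _ _)).
by apply: ler_sum => j _.
Qed.

End Comparison.

Section QformDynamics.
Context (R : realType).

Lemma qform1E N (x : 'cV[R]_N) : qform 1%:M x = \sum_i x i 0 ^+ 2.
Proof.
by rewrite /qform mulmx1 mxE; apply: eq_bigr => i _; rewrite mxE expr2.
Qed.

Lemma qform1_ge0 N (x : 'cV[R]_N) : 0 <= qform 1%:M x.
Proof. by rewrite qform1E; apply: sumr_ge0 => i _; exact: sqr_ge0. Qed.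

Lemma qformD N (P Q : 'M[R]_N) x : qform (P + Q) x = qform P x + qform Q x.
Proof. by rewrite /qform mulmxDr mulmxDl mxE. Qed.

Lemma qformZ N a (P : 'M[R]_N) x : qform (a *: P) x = a * qform P x.
Proof. by rewrite /qform -scalemxAr -scalemxAl mxE. Qed.

Lemma qform_scale N (P : 'M[R]_N) a x : qform P (a *: x) = a ^+ 2 * qform P x.
Proof.
have -> : qform P (a *: x) = ((a *: x^T) *m P *m (a *: x)) 0 0.
  by rewrite /qform; congr ((_ *m _ *m _) 0 0); apply/rowP => i; rewrite !mxE.
by rewrite -scalemxAr -!scalemxAl [LHS]mxE [X in _ * X]mxE mulrA expr2.
Qed.

Lemma cvg_qform (T : Type) (F : set_system T) {FF : Filter F} N (P : 'M[R]_N)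
    (f : T -> 'cV[R]_N) (l : 'cV[R]_N) :
  f x @[x --> F] --> l -> qform P (f x) @[x --> F] --> qform P l.
Proof.
move=> fl; apply: cvg_entry; apply: cvg_mulmx => //.
by apply: cvg_mulmx; [exact: cvg_trmx|exact: cvg_cst].
Qed.

Lemma within_continuous_qform (A : set R) N (P : 'M[R]_N) (x : R -> 'cV[R]_N) :
  {within A, continuous x} -> {within A, continuous (fun t => qform P (x t))}.
Proof. by move=> xc t; apply: (@cvg_qform _ (nbhs t)); exact: xc. Qed.

(** Gronwall's inequality for the squared Euclidean norm; the bound on the
    coefficient is only assumed inside the ball of squared radius [b]. *)
Lemma gronwall_qform N (x : R -> 'cV[R]_N) (A : R -> 'M[R]_N) (M T b : R) :
  {within `[0, +oo[, continuous x} ->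
  (forall t : R, 0 < t -> forall i,
     is_derive t 1 (fun s => x s i 0) ((A t *m x t) i 0)) ->
  (forall t, 0 < t -> qform 1%:M (x t) < b ->
     qform (A t + (A t)^T) (x t) <= M * qform 1%:M (x t)) ->
  0 <= M -> qform 1%:M (x 0) * expR (M * T) < b ->
  forall t, 0 <= t <= T -> qform 1%:M (x t) < b.
Proof.
move=> xc xd xM M0 x0b.
have uc := within_continuous_qform (P := 1%:M) xc.
apply: (first_exit uc) => s /andP[s0 sT] IH.
apply: le_lt_trans x0b.
have H := @expR_comparison R (fun t => - qform 1%:M (x t))
  (fun t => - qform (A t + (A t)^T) (x t)) M s s0.
have : - qform 1%:M (x 0) * expR (M * s) <= - qform 1%:M (x s).
  apply: H => [|t /andP[t0 _]|t /andP[t0 ts]].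
  - move=> t; apply: (@continuousN _ _ (subspace `[0, s])).
    have : {within `[0, s], continuous (fun t => qform 1%:M (x t))}.
      apply: continuous_subspaceW uc => r /=.
      by rewrite !in_itv/= => /andP[->].
    exact.
  - apply: is_deriveN; have := is_derive_qform 1%:M (xd t t0).
    by rewrite mul1mx mulmx1.
  - by rewrite mulrN lerN2 xM// IH// (ltW t0).
rewrite mulNr lerN2 => /le_trans; apply.
by rewrite ler_wpM2l ?qform1_ge0// ler_expR ler_wpM2l.
Qed.

(** [exp (2 a t) * qform P (x t)] is nondecreasing, while it is at most a
    multiple of [exp (2 (a - c) t)], which tends to [0]. *)
Lemma lyapunov_decay N (x : R -> 'cV[R]_N) (A : R -> 'M[R]_N) (P : 'M[R]_N)
    (a c C : R) :
  {within `[0, +oo[, continuous x} ->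
  (forall t : R, 0 < t -> forall i,
     is_derive t 1 (fun s => x s i 0) ((A t *m x t) i 0)) ->
  (forall t, 0 < t ->
     - (2 * a) * qform P (x t) <= qform (P *m A t + (A t)^T *m P) (x t)) ->
  a < c ->
  (forall t, 0 <= t -> qform 1%:M (x t) <= (C * expR (- c * t)) ^+ 2) ->
  qform P (x 0) <= 0.
Proof.
move=> xc xd xP ac xC; rewrite leNgt; apply/negP => P0.
pose B := \sum_i \sum_j `|P i j|; pose D := B * N%:R * C ^+ 2.
have B0 : 0 <= B by apply: sumr_ge0 => i _; exact: sumr_ge0.
have PB i j : `|P i j| <= B.
  rewrite /B (bigD1 i)//= (bigD1 j)//= -addrA lerDl addr_ge0//.
    exact: sumr_ge0.
  by apply: sumr_ge0 => k _; exact: sumr_ge0.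
have D0 : 0 <= D by apply: mulr_ge0; [exact: mulr_ge0|exact: sqr_ge0].
have decay t : 0 <= t -> qform P (x 0) * expR (2 * (c - a) * t) <= D.
  move=> t0; have : qform P (x 0) * expR (- (2 * a) * t) <= qform P (x t).
    apply: (@expR_comparison R (fun t => qform P (x t))
      (fun t => qform (P *m A t + (A t)^T *m P) (x t))) => //.
    - apply: continuous_subspaceW (within_continuous_qform (P := P) xc) => r /=.
      by rewrite !in_itv/= => /andP[->].
    - by move=> s /andP[s0 _]; apply: is_derive_qform; exact: xd.
    - by move=> s /andP[s0 _]; exact: xP.
  have Pt : qform P (x t) <= D * expR (- (2 * c) * t).
    apply: (le_trans (ler_norm _)); apply: (le_trans (qform_bound _ PB)).
    have -> : D * expR (- (2 * c) * t) = B * N%:R * (C * expR (- c * t)) ^+ 2.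
      rewrite exprMn [expR _ ^+ 2]expr2 -expRD mulrA.
      by congr (_ * expR _); ring.
    by rewrite ler_wpM2l ?xC// mulr_ge0.
  move=> /le_trans /(_ Pt); rewrite -(ler_pM2r (expR_gt0 (2 * c * t))).
  rewrite -(mulrA D) -(mulrA (qform P (x 0))) -!expRD.
  rewrite (_ : - (2 * c) * t + 2 * c * t = 0); last by ring.
  rewrite expR0 mulr1.
  by rewrite (_ : - (2 * a) * t + 2 * c * t = 2 * (c - a) * t)//; ring.
pose b := 2 * (c - a); have b0 : 0 < b by rewrite mulr_gt0// subr_gt0.
pose t := D / (qform P (x 0) * b).
have t0 : 0 <= t by rewrite divr_ge0// mulr_ge0// ltW.
have := decay t t0; rewrite leNgt => /negP; apply.
apply: (@lt_le_trans _ _ (qform P (x 0) * (1 + b * t))).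
  have -> : qform P (x 0) * (1 + b * t) = qform P (x 0) + D.
    by rewrite /t; field; rewrite !gt_eqF.
  by rewrite ltrDr.
by rewrite ler_wpM2l ?(ltW P0)// expR_ge1Dx.
Qed.

End QformDynamics.

(** * The distance map and its regular points *)

Section Rigidity.
Context (R : realType) (n d : nat) (G : rel 'I_n).
Implicit Types p q : 'M[R]_(n, d).

Lemma rigidity_mxE p k v c : rigidity_mx G p k (mxvec_index v c) =
  (v == (enum_val k).1)%:R * (p (enum_val k).1 c - p (enum_val k).2 c) +
  (v == (enum_val k).2)%:R * (p (enum_val k).2 c - p (enum_val k).1 c).
Proof.
rewrite mxE; have := enum_valP k; rewrite inE.
case: (enum_val k) => i j /= /andP[ij _]; rewrite mxvecE mxE.
case: eqP => [->|_].
  by rewrite -val_eqE (ltn_eqF ij) !mxE mul1r mul0r addr0.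
case: eqP => _; first by rewrite !mxE mul0r mul1r add0r.
by rewrite mxE !mul0r addr0.
Qed.

Lemma rigidity_mulmx p q k : (rigidity_mx G p *m (mxvec q)^T) k 0 =
  \sum_c (p (enum_val k).2 c - p (enum_val k).1 c) *
         (q (enum_val k).2 c - q (enum_val k).1 c).
Proof.
rewrite mxE (reindex _ (curry_mxvec_bij _ _)) /=.
rewrite (eq_bigr (fun vc : 'I_n * 'I_d =>
  rigidity_mx G p k (mxvec_index vc.1 vc.2) * q vc.1 vc.2)); last first.
  by case=> v c _; rewrite [X in _ * X]mxE mxvecE.
rewrite -(pair_bigA _ (fun v c => rigidity_mx G p k (mxvec_index v c) * q v c)).
rewrite exchange_big; apply: eq_bigr => c _.
under eq_bigr => v _ do rewrite rigidity_mxE mulrDl -!mulrA.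
have pick (w : 'I_n) (x : R) : \sum_v (v == w)%:R * (x * q v c) = x * q w c.
  rewrite (bigD1 w)//= eqxx mul1r big1 ?addr0// => v /negbTE->.
  by rewrite mul0r.
by rewrite big_split /= !pick; ring.
Qed.

(** The distance map is a quadratic form with polarization [rigidity_mx], whence
    an exact difference formula that replaces a Taylor expansion. *)
Lemma distance_map_sub p q :
  distance_map G p - distance_map G q =
  rigidity_mx G (p + q) *m (mxvec (p - q))^T.
Proof.
apply/colP => k; rewrite rigidity_mulmx mxE [X in _ + X]mxE !distance_mapE.
rewrite -sumrB; apply: eq_bigr => c _; rewrite !mxE; ring.
Qed.

Lemma rigidity_mxD p q :
  rigidity_mx G (p + q) = rigidity_mx G p + rigidity_mx G q.
Proof.
apply/matrixP => k l; case/mxvec_indexP: l => v c.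
by rewrite [RHS]mxE !rigidity_mxE !mxE; ring.
Qed.

Section Limits.
Context (T : Type) (F : set_system T) {FF : Filter F}.
Variables (f : T -> 'M[R]_(n, d)) (p : 'M[R]_(n, d)).
Hypothesis fp : f x @[x --> F] --> p.

Lemma cvg_rigidity_mx : rigidity_mx G (f x) @[x --> F] --> rigidity_mx G p.
Proof.
apply: cvg_entries => k l; case/mxvec_indexP: l => v c.
under eq_fun do rewrite rigidity_mxE.
rewrite rigidity_mxE; apply: cvgD; apply: cvgM; try exact: cvg_cst.
  by apply: cvgB; exact: cvg_entry.
by apply: cvgB; exact: cvg_entry.
Qed.

Lemma cvg_distance_map : distance_map G (f x) @[x --> F] --> distance_map G p.
Proof.
apply: cvg_entries => k l; rewrite ord1; under eq_fun do rewrite distance_mapE.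
rewrite distance_mapE; apply: cvg_bigsum => c _; apply: cvg_expr.
by apply: cvgB; exact: cvg_entry.
Qed.

End Limits.

(** If [X *m l *m Y = 1%:M], then [X *m f x *m Y] remains invertible near the
    limit. *)
Lemma rank_lower_semicontinuous (T : Type) (F : set_system T) {FF : Filter F}
    a b (f : T -> 'M[R]_(a, b)) (l : 'M[R]_(a, b)) :
  f x @[x --> F] --> l -> \forall x \near F, (\rank l <= \rank (f x))%N.
Proof.
move=> fl; pose X := pinvmx (col_base l); pose Y := pinvmx (row_base l).
have XlY : X *m l *m Y = 1%:M.
  have -> : X *m l = row_base l.
    transitivity (X *m (col_base l *m row_base l)); first by rewrite mulmx_base.
    by rewrite mulmxA mulVpmx ?mul1mx// col_base_full.
  by rewrite mulmxVp// row_base_free.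
have : \det (X *m f x *m Y) @[x --> F] --> (1 : R).
  rewrite -(det1 _ (\rank l)) -XlY; apply: cvg_det.
  apply: cvg_mulmx; last exact: cvg_cst.
  by apply: cvg_mulmx; first exact: cvg_cst.
move=> /cvgr_neq0 /(_ (oner_neq0 _)); apply: filterS => x.
rewrite -unitfE -unitmxE -row_full_unit => /eqP H.
by rewrite -{1}H (leq_trans (mxrankM_maxl _ _))// mxrankM_maxr.
Qed.

Lemma rank_le_max_rank p : (\rank (rigidity_mx G p) <= max_rank R d G)%N.
Proof.
have lt : (\rank (rigidity_mx G p) < #|edges G|.+1)%N by rewrite ltnS rank_leq_row.
rewrite /max_rank; apply: (bigop.bigmax_sup (Ordinal lt)) => //.
by apply/asboolP; exists p.
Qed.

Lemma compact_box (B : R) :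
  compact [set p : 'M[R]_(n, d) | forall i j, `|p i j| <= B].
Proof.
have -> : [set p : 'M[R]_(n, d) | forall i j, `|p i j| <= B] =
    vec_mx @` [set v : 'rV[R]_(n * d) | forall k, `[- B, B]%classic (v 0 k)].
  apply/seteqP; split=> [p pB|_ [v vB <-] i j].
    exists (mxvec p); last exact: mxvecK.
    by move=> k /=; case/mxvec_indexP: k => i j; rewrite mxvecE in_itv/= -ler_norml.
  by have := vB (mxvec_index i j); rewrite /= in_itv/= -ler_norml mxE.
apply: continuous_compact; last first.
  apply: (@rV_compact _ _ (fun=> `[- B, B]%classic)) => _.
  exact: segment_compact.
apply: continuous_subspaceT => v; apply: (@cvg_entries _ _ (nbhs v)) => i j.
under eq_fun do rewrite mxE; rewrite mxE.
exact: coord_continuous.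
Qed.

Hypotheses (Gsym : symmetric G) (Girr : irreflexive G).

(** Translating each connected component so that a root of it sits at the
    origin changes neither edge lengths nor the rigidity matrix, and makes the
    fibers of the distance map bounded. *)
Definition pinned p : 'M[R]_(n, d) := \matrix_i (row i p - row (fingraph.root G i) p).

Lemma pinned_diff p i j c : G i j ->
  pinned p i c - pinned p j c = p i c - p j c.
Proof.
move=> Gij; rewrite !mxE (_ : fingraph.root G i = fingraph.root G j).
  by ring.
by apply/(fingraph.rootP (sym_connect_sym Gsym)); exact: connect1.
Qed.

Lemma enum_edgeP (k : 'I_#|edges G|) : G (enum_val k).1 (enum_val k).2.
Proof. by have := enum_valP k; rewrite inE => /andP[]. Qed.

Lemma edge_coord_le p i j c B : (forall k, distance_map G p k 0 <= B) ->
  G i j -> `|p j c - p i c| <= B + 1.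
Proof.
move=> pB; wlog ij : i j / (i < j)%N => [H Gij|Gij].
  have [lt|lt|/val_inj ij] := ltngtP i j; first exact: H.
    by rewrite distrC; apply: H => //; rewrite Gsym.
  by move: Gij; rewrite ij Girr.
have ijE : (i, j) \in edges G by rewrite inE /= ij.
have := pB (enum_rank_in ijE (i, j)); rewrite distance_mapE enum_rankK_in//=.
rewrite (bigD1 c)//= => H.
have : `|p j c - p i c| ^+ 2 <= B.
  rewrite real_normK ?num_real//; apply: le_trans H; rewrite lerDl.
  by apply: sumr_ge0 => ? _; exact: sqr_ge0.
have := sqr_ge0 (`|p j c - p i c| - 1).
rewrite sqrrB1 => h1 h2; have := normr_ge0 (p j c - p i c).
by move: h1 h2; set a := `| _ |; nra.
Qed.

Lemma path_coord_le p c i s B :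
  (forall i j, G i j -> `|p j c - p i c| <= B) -> path G i s ->
  `|p (last i s) c - p i c| <= B *+ size s.
Proof.
move=> pB; elim: s i => [|j s IH] i /=; first by rewrite subrr normr0.
move=> /andP[/pB ij /IH js]; rewrite mulrS.
by rewrite (le_trans (ler_distD (p j c) _ _))// [leLHS]addrC lerD.
Qed.

(** A simple path to the root has fewer than [n] edges, and along each of them a
    coordinate changes by at most [|B| + 1], since [x ^+ 2 <= B] gives
    [|x| <= B + 1]. *)
Lemma pinned_le p i c B : (forall k, distance_map G p k 0 <= B) ->
  `|pinned p i c| <= (`|B| + 1) *+ n.
Proof.
move=> pB; rewrite !mxE distrC.
have /connectP[s Gs ->] := connect_root G i.
have [s' Gs' us' _] := shortenP Gs.
apply: (@le_trans _ _ ((`|B| + 1) *+ size s')).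
  apply: path_coord_le Gs' => j k Gjk.
  apply: edge_coord_le Gjk => l.
  by rewrite (le_trans (pB l))// ler_norm.
apply: ler_wpMn2l; first by rewrite addr_ge0.
have /card_uniqP /= := us'; rewrite -[n in leqRHS]card_ord => us.
by apply: ltnW; rewrite -[X in (X <= _)%N]us; exact: max_card.
Qed.

Lemma distance_map_pinned p : distance_map G (pinned p) = distance_map G p.
Proof.
apply/colP => k; rewrite !distance_mapE; apply: eq_bigr => c _.
by rewrite (pinned_diff p c) // Gsym enum_edgeP.
Qed.

Lemma rigidity_mx_pinned p : rigidity_mx G (pinned p) = rigidity_mx G p.
Proof.
apply/matrixP => k l; case/mxvec_indexP: l => v c; rewrite !rigidity_mxE.
by rewrite !(pinned_diff p c) ?enum_edgeP// Gsym enum_edgeP.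
Qed.

(** The pinned configurations of deficient rank with edge lengths bounded by [B]
    form a compact set.  Its image is compact, hence closed, and does not
    contain the given value. *)
Lemma rank_rigidity_fiber_near p :
  (forall q, distance_map G q = distance_map G p ->
     \rank (rigidity_mx G q) = max_rank R d G) ->
  \forall m \near distance_map G p, forall q, distance_map G q = m ->
     \rank (rigidity_mx G q) = max_rank R d G.
Proof.
move=> rankp; pose r := max_rank R d G.
pose B := \sum_k `|distance_map G p k 0| + 1.
pose W := [set q : 'M[R]_(n, d) | (\rank (rigidity_mx G q) < r)%N].
pose Z := [set q : 'M[R]_(n, d) | forall i j, `|q i j| <= (`|B| + 1) *+ n] `&` W.
have Wclosed : closed W.
  rewrite -(setCK W); apply: open_closedC; rewrite openE /W => q /= /negP.
  rewrite -leqNgt => rq.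
  have H : rigidity_mx G q' @[q' --> q] --> rigidity_mx G q.
    by apply: (@cvg_rigidity_mx _ (nbhs q) _ id); exact: cvg_id.
  apply: (filterS _ (rank_lower_semicontinuous H)) => q' qq' /=.
  by apply/negP; rewrite -leqNgt (leq_trans rq).
have FZclosed : closed (distance_map G @` Z).
  apply: compact_closed; first exact: norm_hausdorff.
  apply: continuous_compact; last exact/compact_closedI/Wclosed/compact_box.
  apply: continuous_subspaceT => q.
  by apply: (@cvg_distance_map _ (nbhs q) _ id); exact: cvg_id.
have FZp : ~ (distance_map G @` Z) (distance_map G p).
  by move=> [q [_ Wq] /rankp Fq]; move: Wq; rewrite /W/= Fq ltnn.
have near1 : \forall m \near distance_map G p, ~ (distance_map G @` Z) m.
  by apply: open_nbhs_nbhs; split=> //; exact: closed_openC.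
have near2 : nbhs (distance_map G p)
    [set m : 'cV[R]_#|edges G| | forall k, m k 0 < B].
  suff H k : nbhs (distance_map G p) [set m : 'cV[R]_#|edges G| | m k 0 < B].
    exact: filter_forall H.
  have : (m : 'cV[R]_#|edges G|) k 0 @[m --> distance_map G p] -->
      distance_map G p k 0.
    exact: coord_continuous.
  move/cvgr_lt; apply; rewrite /B (bigD1 k)//=.
  rewrite (le_lt_trans (ler_norm _))// -addrA ltrDl.
  by rewrite ltr_wpDl// sumr_ge0.
apply: filterS2 near1 near2 => m notZ mB q qm.
apply/eqP; rewrite eqn_leq rank_le_max_rank leqNgt; apply/negP => rq.
apply: notZ; exists (pinned q); last by rewrite distance_map_pinned.
split=> [i j|]; last by rewrite /W /= rigidity_mx_pinned.
by apply: pinned_le => k; rewrite qm ltW.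
Qed.

Lemma regular_point_near p : regular_point G p ->
  \forall q \near p, regular_point G q.
Proof.
move=> [[_ [U [V [phi [psi [[Uo Vo] Up smooth bij chart]]]]]] rankp].
have cF : distance_map G q @[q --> p] --> distance_map G p.
  by apply: (@cvg_distance_map _ (nbhs p) _ id); exact: cvg_id.
have nU : \forall q \near p, U (distance_map G q).
  by apply: cF; exact: open_nbhs_nbhs.
have nr := cF _ (rank_rigidity_fiber_near rankp).
apply: filterS2 nU nr => q Uq rankq; split; last exact: rankq.
by split; [exists q|exists U, V, phi, psi; split].
Qed.

End Rigidity.

(** * Trajectories near a stable target *)

Section Stability.
Context (R : realType) (n d : nat) (G : rel 'I_n).
Context (K : fieldType) (iota : {rmorphism K -> R}).
Variable D : set (state R n d G).

Lemma rational_on_graph a b (A : state R n d G -> 'M[R]_(a, b)) i j :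
  rational_on iota D A ->
  exists num den : mpoly (n * d) K, forall p, D (p, distance_map G p) ->
    peval iota den (mxvec p) != 0 /\
    A (p, distance_map G p) i j = peval iota num (mxvec p) / peval iota den (mxvec p).
Proof.
move=> /(_ i j)[num [den H]].
have [num' numE] := @peval_graph R K iota n d G num.
have [den' denE] := @peval_graph R K iota n d G den.
by exists num', den' => p /H; rewrite /= numE denE.
Qed.

Definition graph_dom : set 'M[R]_(n, d) := [set p | D (p, distance_map G p)].

Lemma cvg_rational_on a b (A : state R n d G -> 'M[R]_(a, b)) pstar :
  rational_on iota D A -> graph_dom pstar ->
  A (p, distance_map G p) @[p --> within graph_dom (nbhs pstar)] -->
  A (pstar, distance_map G pstar).
Proof.
move=> rA Dp; apply: cvg_entries => i j.
have [num [den H]] := rational_on_graph i j rA.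
have [den0 ->] := H _ Dp.
have Hc (f : mpoly (n * d) K) :
    peval iota f (mxvec p) @[p --> within graph_dom (nbhs pstar)] -->
    peval iota f (mxvec pstar).
  apply: cvg_trans (@continuous_peval _ _ iota n d f pstar).
  by apply: cvg_app; exact: cvg_within.
have : peval iota num (mxvec p) / peval iota den (mxvec p)
    @[p --> within graph_dom (nbhs pstar)] -->
    peval iota num (mxvec pstar) / peval iota den (mxvec pstar).
  by apply: cvgM => //; exact: cvgV.
apply: cvg_trans; apply: near_eq_cvg; rewrite near_withinE.
by apply: nearW => p /H[_ ->].
Qed.

Lemma enorm_sqr a b (A : 'M[R]_(a, b)) : enorm A ^+ 2 = \sum_i \sum_j A i j ^+ 2.
Proof.
rewrite sqr_sqrtr//; apply: sumr_ge0 => i _; apply: sumr_ge0 => j _.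
exact: sqr_ge0.
Qed.

Lemma entry_le_enorm a b (A : 'M[R]_(a, b)) i j : `|A i j| <= enorm A.
Proof.
rewrite -ler_sqr ?nnegrE ?sqrtr_ge0// enorm_sqr real_normK ?num_real//.
rewrite (bigD1 i)//= (bigD1 j)//= -addrA lerDl addr_ge0//.
  by apply: sumr_ge0 => k _; exact: sqr_ge0.
by apply: sumr_ge0 => k _; apply: sumr_ge0 => l _; exact: sqr_ge0.
Qed.

Lemma within_continuous_entries (A : set R) a b (f : R -> 'M[R]_(a, b)) :
  (forall i j, {within A, continuous (fun t => f t i j)}) ->
  {within A, continuous f}.
Proof. by move=> fc t; apply: (@cvg_entries _ _ (nbhs t)) => i j; exact: fc. Qed.

Lemma within_continuous_entry (A : set R) a b (f : R -> 'M[R]_(a, b)) i j :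
  {within A, continuous f} -> {within A, continuous (fun t => f t i j)}.
Proof. by move=> fc t; apply: (@cvg_entry _ _ (nbhs t)); exact: fc. Qed.

Hypotheses (Gsym : symmetric G) (Girr : irreflexive G).
Variables (nu : state R n d G -> 'M[R]_(n * d, #|edges G|))
          (eta : state R n d G -> 'M[R]_#|edges G|).
Hypothesis ctrl : edge_driven D nu eta.
Variable pstar : 'M[R]_(n, d).
Let mstar := distance_map G pstar.

Let displacement (p : R -> 'M[R]_(n, d)) (t : R) : 'cV[R]_(n * d) :=
  (mxvec (p t - pstar))^T.

Lemma D_state_space s : D s -> state_space s.
Proof. by case: ctrl => [[Q _ ->] _] []. Qed.

Section Solution.
Variables (p : R -> 'M[R]_(n, d)) (m : R -> 'cV[R]_#|edges G|).
Hypothesis sol : is_solution D nu eta mstar p m.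

Let sol_dom t : 0 <= t -> D (p t, m t). Proof. by case: sol => H _ _; exact: H. Qed.

Lemma solution_measurement t : 0 <= t -> m t = distance_map G (p t).
Proof. by move=> /sol_dom/D_state_space[_ _ /= ->]. Qed.

Lemma solution_graph_dom t : 0 <= t -> graph_dom (p t).
Proof. by move=> t0; rewrite /graph_dom/= -solution_measurement//; exact: sol_dom. Qed.

Lemma displacement_continuous : {within `[0, +oo[, continuous (displacement p)}.
Proof.
case: sol => _ [pc _] _; apply: within_continuous_entries => l k.
case/mxvec_indexP: l => i c.
rewrite (_ : (fun t => _) = (fun t => p t i c - pstar i c)); last first.
  by apply/funext => t; rewrite mxE ord1 mxvecE !mxE.
move=> t; apply: (@cvgB _ _ _ (nbhs t)); last exact: cvg_cst.
exact: within_continuous_entry pc t.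
Qed.

Lemma displacement_derive (t : R) : 0 < t -> forall l, is_derive t (1 : R)
  (fun s => displacement p s l 0)
  ((- (nu (p t, distance_map G (p t)) *m rigidity_mx G (p t + pstar)) *m
    displacement p t) l 0).
Proof.
move=> t0 l; have [_ _ /(_ _ t0)[pd _]] := sol.
have mE := solution_measurement (ltW t0).
rewrite mulNmx -mulmxA -distance_map_sub -mulmxN opprB -mE.
case/mxvec_indexP: l => i c.
rewrite (_ : (fun s => _) = (fun s => p s i c - pstar i c)); last first.
  by apply/funext => s; rewrite mxE mxvecE !mxE.
have pdic := is_derive_entry i c pd.
apply: is_derive_eq.
by rewrite subr0 !mxE.
Qed.

Lemma error_continuous : {within `[0, +oo[, continuous (fun t => m t - mstar)}.
Proof.
case: sol => _ [_ mc] _ t.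
by apply: (@cvgB _ _ _ (nbhs t)); [exact: mc|exact: cvg_cst].
Qed.

Lemma error_derive (t : R) : 0 < t -> forall l, is_derive t (1 : R)
  (fun s => (m s - mstar) l 0)
  ((- eta (p t, distance_map G (p t)) *m (m t - mstar)) l 0).
Proof.
move=> t0 l; have [_ _ /(_ _ t0)[_ md]] := sol.
rewrite mulNmx -mulmxN opprB -solution_measurement ?(ltW t0)//.
rewrite (_ : (fun s => _) = (fun s => m s l 0 - mstar l 0)); last first.
  by apply/funext => s; rewrite !mxE.
have mdl := is_derive_entry l 0 md.
by apply: is_derive_eq; rewrite subr0.
Qed.

End Solution.

Hypotheses (rnu : rational_on iota D nu) (reta : rational_on iota D eta).
Hypothesis Dstar : graph_dom pstar.

Lemma near_graph_dom (P : 'M[R]_(n, d) -> Prop) :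
  (\forall p \near within graph_dom (nbhs pstar), P p) ->
  exists2 rho : R, 0 < rho &
    forall p, graph_dom p -> (forall i c, `|p i c - pstar i c| < rho) -> P p.
Proof.
rewrite near_withinE => /nbhs_ballP[rho /= rho0 H]; exists rho => // p Dp pP.
by apply: H => //; split=> // i c; rewrite /ball/= distrC.
Qed.

(** The measurement error is the image of [p - pstar] under the rigidity matrix
    of [p + pstar], so the displacement from the target obeys a linear equation
    whose coefficient is bounded near [pstar]. *)
Lemma displacement_bound : exists2 M, 0 <= M &
  exists2 rho : R, 0 < rho &
  forall p, graph_dom p -> (forall i c, `|p i c - pstar i c| < rho) ->
    let A := - (nu (p, distance_map G p) *m rigidity_mx G (p + pstar)) in
    forall x, qform (A + A^T) x <= M * qform 1%:M x.
Proof.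
pose A p := - (nu (p, distance_map G p) *m rigidity_mx G (p + pstar)).
have Ac : A p + (A p)^T @[p --> within graph_dom (nbhs pstar)] -->
    A pstar + (A pstar)^T.
  have cA : A p @[p --> within graph_dom (nbhs pstar)] --> A pstar.
    apply: cvgN; apply: cvg_mulmx; first exact: cvg_rational_on rnu Dstar.
    apply: cvg_rigidity_mx; apply: cvgD; last exact: cvg_cst.
    exact: cvg_within.
  by apply: cvgD => //; exact: cvg_trmx.
pose B := A pstar + (A pstar)^T.
pose M := \sum_i \sum_j `|B i j| + 1.
have BM i j : `|B i j| < M.
  rewrite /M (bigD1 i)//= (bigD1 j)//= -!addrA ltrDl.
  apply: ltr_wpDl; first exact: sumr_ge0.
  by apply: ltr_wpDl => //; apply: sumr_ge0 => k _; exact: sumr_ge0.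
have M0 : 0 <= M.
  by rewrite /M addr_ge0//; apply: sumr_ge0 => i _; exact: sumr_ge0.
have : \forall p \near within graph_dom (nbhs pstar),
    forall ij : 'I_(n * d) * 'I_(n * d), `|(A p + (A p)^T) ij.1 ij.2| < M.
  apply: filter_forall => -[i j] /=.
  have cij : `|(A p + (A p)^T) i j| @[p --> within graph_dom (nbhs pstar)] -->
      `|B i j|.
    by apply: cvg_norm; exact: cvg_entry.
  exact: (cvgr_lt _ cij _ (BM i j)).
move=> /near_graph_dom[rho rho0 H].
exists (M * (n * d)%:R); first by rewrite mulr_ge0.
exists rho => // p Dp pP Ap x; apply: (le_trans (ler_norm _)).
by apply: qform_bound => i j; rewrite ltW//; exact: (H p Dp pP (i, j)).
Qed.

(** At the target, [P A + A^T P + 2 a P] is the identity by hypothesis; by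
    continuity of [eta] it remains positive semidefinite nearby. *)
Lemma lyapunov_near (P : 'M[R]_#|edges G|) (a : R) :
  P *m (a%:M - eta (pstar, mstar)) + (a%:M - eta (pstar, mstar))^T *m P = 1%:M ->
  exists2 rho : R, 0 < rho &
  forall p, graph_dom p -> (forall i c, `|p i c - pstar i c| < rho) ->
    let A := - eta (p, distance_map G p) in
    forall x, - (2 * a) * qform P x <= qform (P *m A + A^T *m P) x.
Proof.
move=> PE; pose N := #|edges G|.
pose L p := P *m (a%:M - eta (p, distance_map G p)) +
  (a%:M - eta (p, distance_map G p))^T *m P.
have Lc : L p @[p --> within graph_dom (nbhs pstar)] --> (1%:M : 'M[R]_N).
  rewrite -PE.
  have cA : a%:M - eta (p, distance_map G p)
      @[p --> within graph_dom (nbhs pstar)] --> a%:M - eta (pstar, mstar).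
    by apply: cvgB; [exact: cvg_cst|exact: cvg_rational_on reta Dstar].
  apply: cvgD; apply: cvg_mulmx => //; try exact: cvg_cst.
  exact: cvg_trmx.
have : \forall p \near within graph_dom (nbhs pstar),
    forall ij : 'I_N * 'I_N, `|(L p - 1%:M) ij.1 ij.2| < N.+1%:R^-1.
  apply: filter_forall => -[i j] /=.
  have cij : L p i j @[p --> within graph_dom (nbhs pstar)] -->
      (1%:M : 'M[R]_N) i j by exact: cvg_entry.
  move/cvgrPdist_lt : cij => /(_ N.+1%:R^-1).
  rewrite invr_gt0 ltr0n => /(_ isT).
  by apply: filterS => p; rewrite distrC !mxE.
move=> /near_graph_dom[rho rho0 H]; exists rho => // p Dp pP A x.
have LE : L p = (2 * a) *: P + (P *m A + A^T *m P).
  have -> : L p = P *m (a%:M + A) + (a%:M + A^T) *m P.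
    by rewrite /L; congr (_ + _ *m _); apply/matrixP => i j; rewrite !mxE eq_sym.
  rewrite mulmxDr mulmxDl addrACA mul_mx_scalar mul_scalar_mx -scalerDl.
  by congr (_ *: _ + _); ring.
have : 0 <= qform (L p) x.
  rewrite -[L p](subrK 1%:M) qformD.
  have : `|qform (L p - 1%:M) x| <= N.+1%:R^-1 * N%:R * qform 1%:M x.
    by apply: qform_bound => i j; rewrite ltW//; exact: (H p Dp pP (i, j)).
  rewrite ler_norml => /andP[H1 _].
  rewrite -[leLHS](addNr (qform 1%:M x)) lerD2r; apply: le_trans H1.
  rewrite lerN2 ler_piMl ?qform1_ge0// mulrC ler_pdivrMr//.
  by rewrite mul1r ler_nat.
by rewrite LE qformD qformZ; lra.
Qed.

Lemma displacement_entry_lt p t b i c : 0 <= b ->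
  qform 1%:M (displacement p t) < b ^+ 2 -> `|p t i c - pstar i c| < b.
Proof.
move=> b0 H; rewrite -ltr_sqr ?nnegrE//; apply: le_lt_trans H.
rewrite real_normK ?num_real// qform1E (bigD1 (mxvec_index i c))//=.
rewrite mxE mxvecE !mxE lerDl; apply: sumr_ge0 => l _; exact: sqr_ge0.
Qed.

(** Gronwall's inequality keeps the trajectory within [rho / 2] up to time [T].
    Afterwards it is within [rho / 4] of its limit [q], as it already was at
    time [T], so it moves by at most [rho / 2] more. *)
Lemma solution_stays (M rho : R) : 0 <= M -> 0 < rho ->
  (forall p, graph_dom p -> (forall i c, `|p i c - pstar i c| < rho) ->
    let A := - (nu (p, distance_map G p) *m rigidity_mx G (p + pstar)) in
    forall x, qform (A + A^T) x <= M * qform 1%:M x) ->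
  forall p m q (C k T : R), is_solution D nu eta mstar p m ->
    0 <= C -> 0 < k -> 0 <= T ->
    (forall t, 0 <= t -> enorm (q - p t) <= C * expR (- k * t)) ->
    C * expR (- k * T) <= rho / 4 ->
    qform 1%:M (displacement p 0) * expR (M * T) < (rho / 2) ^+ 2 ->
  forall t, 0 <= t -> forall i c, `|p t i c - pstar i c| < rho.
Proof.
move=> M0 rho0 AM p m q C k T sol C0 k0 T0 pq CT p0 t t0 i c.
have early s : 0 <= s <= T -> qform 1%:M (displacement p s) < (rho / 2) ^+ 2.
  move=> sT; apply: (@gronwall_qform R _ (displacement p)
    (fun r => - (nu (p r, distance_map G (p r)) *m rigidity_mx G (p r + pstar)))
    M T) => //.
  - exact: displacement_continuous sol.
  - exact: displacement_derive sol.
  - move=> r r0 rrho; apply: AM => [|j e].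
      by apply: solution_graph_dom sol _ _; exact: ltW.
    have := displacement_entry_lt j e _ rrho.
    by have := rho0; lra.
have early' s : 0 <= s <= T -> `|p s i c - pstar i c| < rho / 2.
  by move=> /early; apply: displacement_entry_lt; lra.
have [tT|Tt] := leP t T.
  by have := early' t; rewrite t0 tT => /(_ isT); lra.
have late s : T <= s -> `|q i c - p s i c| <= rho / 4.
  move=> Ts; apply: le_trans CT.
  have := pq s (le_trans T0 Ts) => /(le_trans (entry_le_enorm _ i c)).
  rewrite !mxE => /le_trans; apply; rewrite ler_wpM2l// ler_expR.
  by rewrite !mulNr lerN2 ler_wpM2l// ltW.
have := late t (ltW Tt); have := late T (lexx _).
have := early' T; rewrite lexx T0 => /(_ isT).
rewrite !ltr_norml !ler_norml; lra.
Qed.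

(** The start is [pstar + s w] with [s] small: the error there is
    [s R(2 pstar + s w) w], so that the sign of the quadratic form is governed
    by its value at [2 R(pstar) w]. *)
Lemma start_near (w : 'rV[R]_(n * d)) (U : set (state R n d G)) (b : R)
    (P : 'M[R]_#|edges G|) :
  within (@state_space R n d G) (nbhs (pstar, mstar)) U -> 0 < b ->
  0 < qform P (rigidity_mx G pstar *m w^T) ->
  exists p : 'M[R]_(n, d),
    [/\ U (p, distance_map G p),
       qform 1%:M (mxvec (p - pstar))^T < b &
       0 < qform P (distance_map G p - mstar)].
Proof.
move=> Un b0 Pw; pose c (s : R) := pstar + s *: vec_mx w.
have cc : c s @[s --> (0 : R)^'+] --> pstar.
  rewrite -[X in _ --> X]addr0; apply: cvgD; first exact: cvg_cst.
  rewrite -[X in _ --> X](scale0r (vec_mx w)); apply: cvgZr_tmp.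
  exact: cvg_at_right_filter.
have cF : distance_map G (c s) @[s --> (0 : R)^'+] --> mstar.
  exact: cvg_distance_map.
have nU : \forall s \near (0 : R)^'+, U (c s, distance_map G (c s)).
  have [/= regstar _ _] := D_state_space Dstar.
  have creg : \forall s \near (0 : R)^'+, regular_point G (c s).
    exact: cc _ (regular_point_near Gsym Girr regstar).
  have nSU : \forall s \near (0 : R)^'+,
      state_space (c s, distance_map G (c s)) -> U (c s, distance_map G (c s)).
    have cp : (c s, distance_map G (c s)) @[s --> (0 : R)^'+] -->
        (pstar, mstar) by exact: (cvg_pair cc cF).
    exact: cp _ Un.
  by apply: filterS2 creg nSU => s cs; apply; split.
have nb : \forall s \near (0 : R)^'+, qform 1%:M (mxvec (c s - pstar))^T < b.
  have : qform 1%:M (mxvec (c s - pstar))^T @[s --> (0 : R)^'+] -->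
      qform 1%:M (mxvec (pstar - pstar))^T.
    apply: cvg_qform; apply: cvg_trmx; apply: cvg_mxvec.
    by apply: cvgB => //; exact: cvg_cst.
  move/cvgr_lt; apply; rewrite subrr linear0 trmx0 qform1E big1 // => l _.
  by rewrite mxE expr0n.
have nP : \forall s \near (0 : R)^'+,
    0 < qform P (rigidity_mx G (c s + pstar) *m w^T).
  have : qform P (rigidity_mx G (c s + pstar) *m w^T) @[s --> (0 : R)^'+] -->
      qform P (rigidity_mx G (pstar + pstar) *m w^T).
    apply: cvg_qform; apply: cvg_mulmx; last exact: cvg_cst.
    by apply: cvg_rigidity_mx; apply: cvgD => //; exact: cvg_cst.
  move/cvgr_gt; apply; rewrite rigidity_mxD mulmxDl -mulr2n -scaler_nat.
  by rewrite qform_scale mulr_gt0.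
have [s [Us bs Ps s0]] : exists s : R, [/\ U (c s, distance_map G (c s)),
    qform 1%:M (mxvec (c s - pstar))^T < b,
    0 < qform P (rigidity_mx G (c s + pstar) *m w^T) & 0 < s].
  near (0 : R)^'+ => s; exists s; split; near: s => //.
  exact: nbhs_right_gt.
exists (c s); split=> //; rewrite distance_map_sub.
rewrite [c s - pstar]addrC addKr linearZ/= vec_mxK linearZ/= -scalemxAr.
by rewrite qform_scale mulr_gt0// exprn_gt0.
Unshelve. all: by end_near. Qed.

End Stability.

(** * From one stable target to generic hyperbolicity *)

(** The rows of [V] span the tangent space at the target, or a subspace of it
    that contains the range of [eta*]; [V *m Y] is then the restriction of
    [eta*]. *)
Lemma exp_stable_spectrum (R : realType) (n d : nat) (G : rel 'I_n)
    (K : fieldType) (iota : {rmorphism K -> R}) (D : set (state R n d G))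
    (nu : state R n d G -> 'M[R]_(n * d, #|edges G|))
    (eta : state R n d G -> 'M[R]_#|edges G|) (pstar : 'M[R]_(n, d))
    (r : nat) (Y : 'M[R]_(#|edges G|, r)) (V : 'M[R]_(r, #|edges G|)) :
  symmetric G -> irreflexive G -> edge_driven D nu eta ->
  rational_on iota D nu -> rational_on iota D eta ->
  D (pstar, distance_map G pstar) -> locally_exp_stable D nu eta pstar ->
  (eta (pstar, distance_map G pstar))^T = Y *m V -> row_free V ->
  (V <= (rigidity_mx G pstar)^T)%MS ->
  forall z, cplx_roots (char_poly (V *m Y)) z -> 0 < complex.Re z.
Proof.
move=> Gsym Girr ctrl rnu reta Dstar [U [C [c [K' [k [_ Un]]]]]].
move=> [C0 c0 K0 k0] stab etaE Vfree /submxP[W VE] z hz.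
rewrite ltNge; apply/negP => z0.
have [a [P [y [/andP[a0 ac] _ PE Py]]]] := lyapunov_unstable etaE Vfree hz z0 c0.
have [M M0 [rho1 rho10 H1]] := displacement_bound rnu Dstar.
have [rho2 rho20 H2] := lyapunov_near reta Dstar PE.
pose rho := Num.min rho1 rho2.
have rho0 : 0 < rho by rewrite lt_min rho10.
(* From this time on, [K' * expR (- k * t) <= K' / (k * t) <= rho / 4]. *)
pose T := 4 * K' / (k * rho).
have T0 : 0 <= T by rewrite divr_ge0 ?mulr_ge0// ltW.
have KT : K' * expR (- k * T) <= rho / 4.
  rewrite mulNr expRN ler_pdivrMr ?expR_gt0//.
  apply: (@le_trans _ _ (rho / 4 * (k * T))).
    by rewrite /T le_eqVlt; apply/orP; left; apply/eqP; field; rewrite !gt_eqF.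
  rewrite ler_pM2l ?divr_gt0//; apply: le_trans (expR_ge1Dx _).
  by rewrite lerDr.
pose b := (rho / 2) ^+ 2 / expR (M * T).
have b0 : 0 < b by rewrite divr_gt0 ?expR_gt0// exprn_gt0// divr_gt0.
have Pw : 0 < qform P (rigidity_mx G pstar *m (y *m W)^T).
  rewrite (_ : rigidity_mx G pstar *m _ = (y *m V)^T) /qform ?trmxK//.
  by rewrite VE !trmx_mul trmxK mulmxA.
have [p0 [Up0 p0b Pp0]] := start_near Gsym Girr ctrl Dstar Un b0 Pw.
have [p [m [sol [/= pE mE] mdecay [q _ pq]]]] := stab _ Up0.
have stay t : 0 <= t -> forall i j, `|p t i j - pstar i j| < rho.
  move=> t0; apply: (solution_stays ctrl M0 rho0 _ sol (ltW K0) k0 T0 pq KT) => //.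
    move=> p' Dp' p'rho; apply: H1 => // i j.
    by apply: lt_le_trans (p'rho i j) _; rewrite ge_min lexx.
  by rewrite pE -ltr_pdivlMr ?expR_gt0.
have : qform P (m 0 - distance_map G pstar) <= 0; last by rewrite mE leNgt Pp0.
apply: (@lyapunov_decay R _ (fun t => m t - distance_map G pstar)
  (fun t => - eta (p t, distance_map G (p t))) P a c C) => //.
- exact: error_continuous sol.
- exact: (error_derive ctrl sol).
- move=> t t0; apply: H2 => [|i j].
    by apply: (solution_graph_dom ctrl sol); exact: ltW.
  by apply: lt_le_trans (stay t (ltW t0) i j) _; rewrite ge_min lexx orbT.
- move=> t t0; rewrite qform1E.
  have -> : \sum_i (m t - distance_map G pstar) i 0 ^+ 2 =
      enorm (distance_map G pstar - m t) ^+ 2.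
    rewrite enorm_sqr; apply: eq_bigr => i _; rewrite big_ord1.
    by rewrite -sqrrN -opprB !mxE opprK.
  by rewrite ler_sqr ?nnegrE ?sqrtr_ge0 ?mulr_ge0 ?expR_ge0 ?(ltW C0)// mdecay.
Qed.

(** Clearing denominators multiplies [eta] by a nonzero real scalar, which does
    not affect whether two eigenvalues have sum zero. *)
Lemma spectrum_polynomial (R : realType) (n d : nat) (G : rel 'I_n)
    (K : fieldType) (iota : {rmorphism K -> R}) (D : set (state R n d G))
    (eta : state R n d G -> 'M[R]_#|edges G|) :
  rational_on iota D eta -> (max_rank R d G <= #|edges G|)%N ->
  exists f : mpoly (n * d) K, forall p r (Y : 'M[R]_(#|edges G|, r)) V,
    D (p, distance_map G p) -> r = max_rank R d G ->
    (eta (p, distance_map G p))^T = Y *m V ->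
    peval iota f (mxvec p) != 0 <-> sums_nonzero (char_poly (V *m Y)).
Proof.
move=> reta rE; pose E := #|edges G|.
have /choice[F FE] : forall ij : 'I_E * 'I_E,
    exists nd : mpoly (n * d) K * mpoly (n * d) K,
    forall p, D (p, distance_map G p) ->
      peval iota nd.2 (mxvec p) != 0 /\
      eta (p, distance_map G p) ij.1 ij.2 =
        peval iota nd.1 (mxvec p) / peval iota nd.2 (mxvec p).
  move=> [i j]; have [num [den H]] := rational_on_graph i j reta.
  by exists (num, den).
pose A : 'M[mpoly (n * d) K]_E :=
  \matrix_(j, i) ((F (i, j)).1 * \prod_(kl | kl != (i, j)) (F kl).2).
have [f fE] := sums_nonzero_polynomial A rE.
exists f => p r Y V Dp rr etaE.
pose delta := \prod_kl peval iota (F kl).2 (mxvec p).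
have delta0 : delta != 0.
  by rewrite prodf_seq_neq0; apply/allP => kl _; have [] := FE kl p Dp.
have AE : map_mx (peval_rmorphism iota (mxvec p)) A = (delta *: Y) *m V.
  rewrite -scalemxAl -etaE; apply/matrixP => j i.
  rewrite [LHS]mxE [A j i]mxE rmorphM rmorph_prod -!pevalE.
  rewrite [RHS]mxE [X in _ = _ * X]mxE.
  have [den0 /= ->] := FE (i, j) p Dp.
  rewrite [X in _ = X * _](bigD1 (i, j))//= !pevalE.
  by rewrite [RHS]mulrC -mulrA; congr (_ * _); rewrite mulrA mulVf ?mul1r.
rewrite pevalE (fE _ _ _ _ _ rr AE) -scalemxAr.
split; last exact: sums_nonzero_char_polyZ.
move=> /(sums_nonzero_char_polyZ (invr_neq0 delta0)).
by rewrite scalerA mulVf// scale1r.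
Qed.

Theorem theorem4 (R : realType) (n d : nat) (G : rel 'I_n)
    (hd : (0 < d)%N) (Gsym : symmetric G) (Girr : irreflexive G)
    (Grigid : d_rigid R d G) :
  generically (@ratr R) (fun pstar : 'M[R]_(n, d) =>
    forall (K : fieldType) (iota : {rmorphism K -> R})
      (D : set (state R n d G))
      (nu : state R n d G -> 'M[R]_(n * d, #|edges G|))
      (eta : state R n d G -> 'M[R]_#|edges G|),
      edge_driven D nu eta ->
      rational_on iota D nu -> rational_on iota D eta ->
      D (pstar, distance_map G pstar) ->
      locally_exp_stable D nu eta pstar ->
      dynamically_admissible iota D eta).
Proof.
(* Regularity of the stable target follows from its lying in [D]; the constant
   polynomial [1] makes the exceptional set empty. *)
apply: (@generically_neq0 _ _ _ _ _ 1 0).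
  by rewrite pevalE rmorph1 oner_neq0.
move=> pstar _ K iota D nu eta ctrl rnu reta Dstar stab.
pose B p := (rigidity_mx G p)^T : 'M[R]_(n * d, #|edges G|).
pose V p := row_base (B p).
pose Y p := (eta (p, distance_map G p))^T *m pinvmx (V p).
have etaE p : D (p, distance_map G p) ->
    (eta (p, distance_map G p))^T = Y p *m V p.
  move=> Dp; rewrite mulmxKpV// eq_row_base.
  have [_ /(_ _ Dp)->] := ctrl.
  by rewrite linearZ/= trmx_mul scalemxAl submxMl.
have rankE p : D (p, distance_map G p) -> \rank (B p) = max_rank R d G.
  by move=> Dp; have [/= [_ H] _ _] := D_state_space ctrl Dp;
     rewrite mxrank_tr H.
have [|f fP] := spectrum_polynomial reta.
  by rewrite -(rankE _ Dstar) rank_leq_col.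
apply: (@generically_neq0 _ _ _ _ _ f pstar).
  apply/(fP _ _ _ _ Dstar (rankE _ Dstar) (etaE _ Dstar)).
  apply: sums_nonzero_pos.
  apply: (exp_stable_spectrum Gsym Girr ctrl rnu reta Dstar stab (etaE _ Dstar)).
    exact: row_base_free.
  by rewrite eq_row_base.
move=> p fp Dp z; rewrite /hyperbolic_on eigenvalue_root_char -map_char_poly.
have /(_ fp) := (fP _ _ _ _ Dp (rankE _ Dp) (etaE _ Dp)).1.
rewrite /V /Y mulmxA => /sums_nonzero_imaginary; apply.
Qed.
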